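(* Let $\mathcal{T}=(V,E,\varrho)$ be a locally finite, infinite rooted tree of intermediate growth, and let $\alpha=\mathrm{IBN}(\mathcal{T})$. Let $\lambda\in(0,1)$ and let $(C_e)_{e\in E}$ be i.i.d. random variables taking values in $(0,\infty)$ such that for all $t\ge 1$ and every $e\in E$, $$\mathbb{P}\left[C_e<\exp(-t^{\lambda})\right]=L(t)\,t^{\lambda-1},$$ where $L:[1,\infty)\to\mathbb{R}_+$ is slowly varying. Given a realization of $(C_e)_{e\in E}$, let $\mathbf{X}=(X_n)_{n\ge 0}$ be the random walk on $\mathcal{T}$ started at $X_0=\varrho$ which moves from a vertex $\mu$ to a neighbour $\nu$ with probability $C_{\{\mu,\nu\}}/\sum_{\nu'\sim\mu}C_{\{\mu,\nu'\}}$. If $\lambda>\alpha$, then for almost every realization of $(C_e)_{e\in E}$ the walk $\mathbf{X}$ is recurrent. If $\lambda<\alpha$, then for almost every realization of $(C_e)_{e\in E}$ the walk $\mathbf{X}$ is transient.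
   Context: For a rooted tree $\mathcal{T}=(V,E,\varrho)$, $|v|$ is the graph distance from $v$ to the root $\varrho$. For an edge $e$ with endpoints $e^-,e^+$ where $|e^+|=|e^-|+1$, put $|e|=|e^+|$. Let $E_n=\{x\in V: |x|=n\}$. The tree is of intermediate growth if $$0<\liminf_{n\to\infty}\frac{\log\log\#E_n}{\log n}\le\limsup_{n\to\infty}\frac{\log\log\#E_n}{\log n}<1.$$ A cutset is a set $\pi\subset E$ such that every infinite self-avoiding path from $\varrho$ to infinity has exactly one edge in $\pi$; $\Pi$ is the set of all cutsets. The intermediate branching number is $$\mathrm{IBN}(\mathcal{T})=\sup\Big\{\lambda>0:\ \inf_{\pi\in\Pi}\sum_{e\in\pi}\exp(-|e|^{\lambda})>0\Big\},$$ with the convention $\sup\emptyset=0$. A function $L:[1,\infty)\to\mathbb{R}_+$ is slowly varying if $\lim_{t\to\infty}L(at)/L(t)=1$ for all $a>0$. *)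

(* Defs.v *)
From HB Require Import structures.
From mathcomp Require Import all_boot all_order all_algebra.
From mathcomp Require Import finmap.
From mathcomp Require Import all_classical all_reals all_analysis.

Set Implicit Arguments.
Unset Strict Implicit.
Unset Printing Implicit Defensive.

Import Order.TTheory GRing.Theory Num.Theory.
Import numFieldNormedType.Exports.

Local Open Scope classical_set_scope.
Local Open Scope ring_scope.

Section Graph.
Variables (V : choiceType) (adj : rel V).

Definition simple_graph : Prop := symmetric adj /\ irreflexive adj.

Definition walk_of_length (x y : V) (n : nat) : Prop :=
  exists p : seq V, [/\ path adj x p, last x p = y & size p = n].

Definition graph_connected : Prop :=
  forall x y, exists n, walk_of_length x y n.

(* [ucycle adj [:: x; y]] holds for every edge xy, hence the size condition. *)
Definition acyclic : Prop :=
  forall c : seq V, ucycle adj c -> (size c <= 2)%N.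

Definition is_tree : Prop := [/\ simple_graph, graph_connected & acyclic].

Definition nbrs (x : V) : set V := [set y | adj x y].

Definition locally_finite : Prop := forall x, finite_set (nbrs x).

(* The default value 0 is only used when x and y are not connected. *)
Definition gdist (x y : V) : nat :=
  xget 0%N [set n | walk_of_length x y n /\
                    forall m, walk_of_length x y m -> (n <= m)%N].

(* Edges are unordered pairs, i.e. two-element finite sets of vertices. *)
Definition edges : set {fset V} :=
  [set e | exists x y, adj x y /\ e = [fset x; y]%fset].

Variable root : V.

Definition depth (v : V) : nat := gdist root v.

(* |e| = |e^+|: the larger of the depths of the two endpoints. *)
Definition edge_depth (e : {fset V}) : nat := \max_(v <- e) depth v.

Definition level (n : nat) : set V := [set x | depth x = n].

Definition ray (r : nat -> V) : Prop :=
  [/\ r 0%N = root, forall n, adj (r n) (r n.+1) & injective r].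

Definition cutset (pi : set {fset V}) : Prop :=
  pi `<=` edges /\
  forall r, ray r ->
    exists! e, pi e /\ exists n, e = [fset r n; r n.+1]%fset.

Variable R : realType.

(* [ln] takes the value 0 at 0, so a level with #E_n = 1 contributes 0 here
   instead of -oo. If this happens for infinitely many n, then the lower limit
   is <= 0 under either convention. *)
Definition loglog_ratio (n : nat) : R :=
  ln (ln (#|` fset_set (level n)|%:R)) / ln n%:R.

Definition intermediate_growth : Prop :=
  let u := fun n => (loglog_ratio n)%:E in
  [/\ (0 < limn_einf u)%E, (limn_einf u <= limn_esup u)%E
    & (limn_esup u < 1)%E].

Definition cutset_sum (lam : R) (pi : set {fset V}) : \bar R :=
  (\esum_(e in pi) (expR (- ((edge_depth e)%:R `^ lam)))%:E)%E.

(* Adjoining 0 to this set of positive numbers encodes the convention that the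
   supremum of the empty set is 0; it does not change the supremum otherwise. *)
Definition IBN : \bar R :=
  ereal_sup ([set 0%E] `|`
    [set lam%:E | lam in
      [set lam : R | 0 < lam /\
        (0 < ereal_inf [set cutset_sum lam pi | pi in cutset])%E]]).

Definition trans_prob (c : {fset V} -> R) (x y : V) : R :=
  if adj x y
  then c [fset x; y]%fset / \sum_(z \in nbrs x) c [fset x; z]%fset
  else 0.

(* The Markov property in product form, so that one never conditions on a null
   event. Together with X_0 = root it determines the law of X. *)
Definition random_walk (c : {fset V} -> R) d (T : measurableType d)
    (Q : probability T R) (X : nat -> T -> V) : Prop :=
  [/\ forall n x, measurable [set w | X n w = x],
      Q [set w | X 0%N w = root] = 1%E
    & forall (n : nat) (x : nat -> V),
        (Q [set w | forall i, (i <= n.+1)%N -> X i w = x i] =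
         Q [set w | forall i, (i <= n)%N -> X i w = x i] *
         (trans_prob c (x n) (x n.+1))%:E)%E].

Definition returns_to_root d (T : measurableType d) (X : nat -> T -> V) : set T :=
  [set w | exists2 n, (0 < n)%N & X n w = root].

Definition recurrent d (T : measurableType d) (Q : probability T R)
  (X : nat -> T -> V) : Prop := Q (returns_to_root X) = 1%E.

Definition transient d (T : measurableType d) (Q : probability T R)
  (X : nat -> T -> V) : Prop := (Q (returns_to_root X) < 1)%E.

End Graph.

Section Probability.
Variables (R : realType) (d : measure_display) (T : measurableType d).
Variables (P : probability T R) (I : choiceType).

Definition independent_on (D : set I) (C : I -> {RV P >-> R}) : Prop :=
  forall (J : {fset I}) (B : I -> set R),
    [set` J] `<=` D -> (forall i, measurable (B i)) ->
    P (\bigcap_(i in [set` J]) (C i @^-1` B i)) =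
    (\prod_(i <- J) P (C i @^-1` B i))%E.

Definition identically_distributed_on (D : set I) (C : I -> {RV P >-> R}) : Prop :=
  forall i j, D i -> D j ->
    forall B : set R, measurable B ->
      distribution P (C i) B = distribution P (C j) B.

End Probability.

(* L is given on all of R, but only its values on [1, +oo[ matter. *)
Definition slowly_varying (R : realType) (L : R -> R) : Prop :=
  (forall t, 1 <= t -> 0 <= L t) /\
  forall a, 0 < a -> L (a * t) / L t @[t --> +oo] --> (1 : R).

(* Main.v *)
Require Import Defs.
From HB Require Import structures.
From mathcomp Require Import all_boot all_order all_algebra.
From mathcomp Require Import finmap.
From mathcomp Require Import all_classical all_reals all_analysis.
From mathcomp Require Import measurable_realfun.
From mathcomp Require Import ring lra zify.

Import Order.TTheory GRing.Theory Num.Theory.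
Import numFieldNormedType.Exports.

Set Implicit Arguments.
Unset Strict Implicit.
Unset Printing Implicit Defensive.

Local Open Scope classical_set_scope.
Local Open Scope ring_scope.

(** Recurrence and transience of the walk are governed by the probability
    [noret_lim root] of never returning to the root, which the product form of
    the walk turns into the limit of a deterministic recursion [noret n root]
    in the conductances ([walk_noret]).  Everything then becomes a question about
    the electrical network, and on a tree an edge can be named by its lower
    endpoint.

    Recurrence ([ae_recurrence]).  Take IBN < lam' < lam.  Some cutset has
    arbitrarily small [sum exp(-|e|^lam')], and by König's lemma finitely many of
    its edges suffice.  A conductance falls below [exp(-n^lam)] with probability
    [n^(lam-1)] up to a slowly varying factor, so among the [n] edges of the path
    from the root to an edge of depth [n] none does so with probability about
    [exp(-n^lam)], hence at most [exp(-n^lam')].  By a union bound, with high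
    probability every edge [e] of the cutset can be replaced by an edge above it
    of conductance at most [exp(-|e|^lam)].  The new cutset has small total
    conductance, and the Nash-Williams inequality ([nash_williams],
    [cut_noret]) makes the escape probability small.

    Transience ([ae_transience]).  Take lam < lam' < IBN.  By max-flow min-cut
    ([flow_exists]) each finite truncation of the tree carries a unit flow
    [theta] with [theta e <= exp(-|e|^lam')/c0].  Call an edge of depth [k] open
    if its conductance is at least [exp(-k^lam)]; a path of depth [n] is open
    with probability about [exp(-n^lam)], up to a slightly larger power.
    Reweighting the leaf masses of [theta] by the open paths gives a random flow
    of mean one; since [exp(-n^lam')] beats the inverse of the probability that
    a path is open, its variance and its energy are small when percolation is
    only performed below a large depth [m] ([second_moment], [P_bad]).  Dropping
    the leaves of large potential turns such a flow into a bounded harmonic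
    function, which bounds the escape probability from below uniformly in the
    truncation ([pot_noret], [good_noret]).  The failure probability is of order
    [1/m], and transience depends on no [m], so letting [m] grow yields an almost
    sure statement. *)

(** * Rooted trees *)

Section Tree.
Variables (V : choiceType) (adj : rel V) (root : V).
Hypothesis htree : is_tree adj.
Hypothesis hlf : locally_finite adj.
Hypothesis hinf : infinite_set [set: V].

Let adjC : symmetric adj. Proof. by case: htree => -[]. Qed.
Let adjI : irreflexive adj. Proof. by case: htree => -[]. Qed.
Let adj_acyclic : acyclic adj. Proof. by case: htree. Qed.
Let adj_conn : graph_connected adj. Proof. by case: htree. Qed.

Local Notation depth := (depth adj root).

Lemma depthP x : walk_of_length adj root x (depth x) /\
  forall m, walk_of_length adj root x m -> (depth x <= m)%N.
Proof.
rewrite /Defs.depth /gdist; case: xgetP => [n _ []//|H].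
have [n0 Hn0] := adj_conn root x.
pose Q := fun n => `[< walk_of_length adj root x n >].
have exQ : exists n, Q n by exists n0; apply/asboolP.
case: (ex_minnP exQ) => m /asboolP Qm mmin.
exfalso; apply: (H m); split=> // k Qk; apply: mmin; exact/asboolP.
Qed.

Lemma depth_root : depth root = 0%N.
Proof.
by apply/eqP; rewrite -leqn0; apply: (depthP root).2; exists [::].
Qed.

Lemma depth_eq0 x : (depth x == 0%N) = (x == root).
Proof.
apply/eqP/eqP => [H|->]; last exact: depth_root.
have [[p [_ lp sz]] _] := depthP x.
by rewrite H in sz; rewrite (size0nil sz) in lp.
Qed.

Lemma depth_adj x y : adj x y -> (depth y <= (depth x).+1)%N.
Proof.
move=> xy; have [[p [pp lp sz]] _] := depthP x.
apply: (depthP y).2; exists (rcons p y); split.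
- by rewrite rcons_path pp lp.
- by rewrite last_rcons.
- by rewrite size_rcons sz.
Qed.

Lemma exists_parent x : x != root ->
  exists y, adj x y /\ depth x = (depth y).+1.
Proof.
rewrite -depth_eq0 => x0; have [[p [pp lp sz]] _] := depthP x.
case/lastP: p pp lp sz => [|p z]; first by move=> _ _ /= e; rewrite -e in x0.
rewrite rcons_path last_rcons size_rcons => /andP[pp az] zx sz; subst z.
exists (last root p); split; first by rewrite adjC.
apply/eqP; rewrite eqn_leq depth_adj //= -sz ltnS.
by apply: (depthP _).2; exists p.
Qed.

Lemma path_to_root x : exists p,
  [/\ path adj x p, last x p = root & all (fun z => depth z < depth x)%N p].
Proof.
have [n] := ubnP (depth x); elim: n x => // n IH x.
have [->|xr] := eqVneq x root; first by exists [::].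
have [y [xy dy]] := exists_parent xr; rewrite dy ltnS => yn.
have [p [pp lp ap]] := IH y yn.
exists (y :: p); split => //=; first by rewrite xy.
by rewrite ltnSn /=; apply: sub_all ap => z; lia.
Qed.

(** Two distinct neighbours of [x] joined by a path that avoids [x] would close
    a cycle through [x]. *)
Lemma nbr_path_eq x y y' p : adj x y -> adj x y' -> path adj y p ->
  last y p = y' -> x \notin y :: p -> y = y'.
Proof.
move=> xy xy' pp; case/shortenP: pp => q qq uq sq lq xnp.
have xnq : x \notin y :: q.
  apply: contra xnp; rewrite !inE => /orP[->//|/sq ->]; exact: orbT.
have := adj_acyclic (c := x :: y :: q).
have uc : ucycle adj [:: x, y & q].
  apply/andP; split; last by rewrite cons_uniq xnq.
  by rewrite /cycle rcons_cons /= xy rcons_path qq lq adjC.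
move=> /(_ uc) /=; case: q lq {qq uq sq xnq uc} => //= ->; by [].
Qed.

(** Geodesics to the root from two neighbours no deeper than [x] avoid [x], so
    they join these neighbours without passing through [x]. *)
Lemma low_nbr_unique x y y' : adj x y -> adj x y' ->
  (depth y <= depth x)%N -> (depth y' <= depth x)%N -> y = y'.
Proof.
move=> xy xy' dy dy'.
have avoid z : adj x z -> (depth z <= depth x)%N ->
    exists p, [/\ path adj z p, last z p = root & x \notin z :: p].
  move=> xz dz; have [p [pp lp ap]] := path_to_root z; exists p; split=> //.
  rewrite inE negb_or; apply/andP; split.
    by apply/eqP => e; move: xz; rewrite e adjI.
  by apply/negP => /(allP ap); lia.
have [p [pp lp xp]] := avoid _ xy dy.
have [q [pq lq xq]] := avoid _ xy' dy'.
apply: (@nbr_path_eq x y y' (p ++ rev (belast y' q))) => //.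
- rewrite cat_path pp lp -lq rev_path.
  by rewrite (eq_path (e' := adj)) // => a b; rewrite adjC.
- rewrite last_cat lp; case: q lq {pq xq} => [|a q] /= lq; first by rewrite lq.
  by rewrite rev_cons last_rcons.
- rewrite -cat_cons mem_cat negb_or xp mem_rev.
  by apply: contra xq => /mem_belast.
Qed.

Lemma low_nbr_depth x y : adj x y -> (depth y <= depth x)%N ->
  depth x = (depth y).+1.
Proof.
move=> xy dy; have xr : x != root.
  apply/eqP => e; move: dy; rewrite e depth_root leqn0 depth_eq0 => /eqP e'.
  by move: xy; rewrite e e' adjI.
have [z [xz dz]] := exists_parent xr.
by rewrite (low_nbr_unique xy xz) //; lia.
Qed.

(** The value at the root is the root itself ([par_root]), so that iterating
    [par] is harmless. *)
Definition par x := xget root [set y | adj x y /\ depth x = (depth y).+1].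

Lemma parP x : x != root -> adj x (par x) /\ depth x = (depth (par x)).+1.
Proof.
move=> /exists_parent[y Hy]; rewrite /par; case: xgetP => [z -> //|H].
by case: (H y).
Qed.

Lemma par_root : par root = root.
Proof. by rewrite /par; case: xgetP => // y _ []; rewrite depth_root. Qed.

Lemma par_uniq x y : adj x y -> (depth y <= depth x)%N -> y = par x.
Proof.
move=> xy dy; have xr : x != root.
  by rewrite -depth_eq0 (low_nbr_depth xy dy).
have [xz dz] := parP xr.
by apply: (low_nbr_unique xy xz) => //; lia.
Qed.

Definition nb x : seq V := fset_set (nbrs adj x).

Lemma mem_nb x y : (y \in nb x) = adj x y.
Proof. by rewrite /nb in_fset_set //; apply/idP/idP; rewrite inE. Qed.

Lemma uniq_nb x : uniq (nb x). Proof. exact: fset_uniq. Qed.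

Definition kids x := [seq y <- nb x | depth y == (depth x).+1].

Lemma mem_kids x y : (y \in kids x) = (y != root) && (par y == x).
Proof.
rewrite mem_filter mem_nb; apply/andP/andP => -[].
  move=> /eqP dy xy; rewrite -depth_eq0 dy; split=> //.
  apply/eqP/esym/par_uniq; [by rewrite adjC|lia].
by move=> /parP[yp dy] /eqP <-; rewrite dy adjC yp.
Qed.

Lemma kids_depth x y : y \in kids x -> depth y = (depth x).+1.
Proof. by rewrite mem_filter => /andP[/eqP]. Qed.

Lemma uniq_kids x : uniq (kids x). Proof. exact/filter_uniq/uniq_nb. Qed.

Lemma nb_perm x : x != root -> perm_eq (nb x) (par x :: kids x).
Proof.
move=> xr; apply: uniq_perm; rewrite ?uniq_nb //=.
  rewrite uniq_kids andbT; apply/negP => /kids_depth.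
  by have [_] := parP xr; lia.
move=> y; rewrite inE mem_nb mem_filter mem_nb.
apply/idP/orP => [xy|[/eqP ->|/andP[]//]]; last by have [] := parP xr.
have [dy|dy] := leqP (depth y) (depth x); first by left; apply/eqP/par_uniq.
by right; rewrite xy eqn_leq dy depth_adj.
Qed.

Lemma nb_root : nb root = kids root.
Proof.
rewrite /kids; apply/esym/all_filterP/allP => y; rewrite mem_nb => ry.
rewrite depth_root eqn_leq -{1}depth_root depth_adj // lt0n depth_eq0.
by apply/eqP => e; move: ry; rewrite e adjI.
Qed.

Fixpoint lev n : seq V :=
  if n is m.+1 then flatten [seq kids x | x <- lev m] else [:: root].

Lemma mem_lev n x : (x \in lev n) = (depth x == n).
Proof.
elim: n x => [|n IH] x /=; first by rewrite inE depth_eq0.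
apply/flattenP/eqP => [[s /mapP[y yn ->] /kids_depth ->]|dx].
  by move: yn; rewrite IH => /eqP ->.
have xr : x != root by rewrite -depth_eq0 dx.
exists (kids (par x)); last by rewrite mem_kids xr eqxx.
by apply/map_f; rewrite IH; have [_] := parP xr; rewrite dx => -[->].
Qed.

Lemma uniq_lev n : uniq (lev n).
Proof.
elim: n => [//|n IH] /=.
have : {subset lev n <= [set: V]} by move=> x _; rewrite inE.
elim: (lev n) IH => //= x s IHs /andP[xs us] _.
rewrite cat_uniq uniq_kids /= IHs // ?andbT; last by move=> ? _; rewrite inE.
apply/hasPn => y /flattenP[_ /mapP[z zs ->]].
rewrite !mem_kids => /andP[-> /eqP ->] /=.
by apply: contra xs => /eqP <-.
Qed.

Lemma nb_neq0 x : nb x != [::].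
Proof.
apply/negP => /eqP nb0; apply: hinf.
suff -> : [set: V] = [set x] by exact: finite_set1.
apply/seteqP; split=> // y _ /=.
have [n [p [pp <- _]]] := adj_conn x y.
by case: p pp => //= a p /andP[]; rewrite -mem_nb nb0.
Qed.

(** ** Ancestors *)

(** [below x y] says that [x] lies on the path from the root to [y]; when
    [depth y < depth x] the subtraction truncates and the test is [y == x],
    which is then false. *)
Definition below x y := iter (depth y - depth x) par y == x.

Lemma depth_iter_par k x : depth (iter k par x) = (depth x - k)%N.
Proof.
elim: k => [|k IH] /=; first by rewrite subn0.
have [e|/parP[_]] := eqVneq (iter k par x) root; last by rewrite IH; lia.
have : depth (iter k par x) = 0%N by rewrite e depth_root.
rewrite IH => e0; rewrite e.
by rewrite par_root depth_root; lia.
Qed.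

Lemma belowxx x : below x x. Proof. by rewrite /below subnn. Qed.

Lemma below_depth x y : below x y -> (depth x <= depth y)%N.
Proof. by move=> /eqP <-; rewrite depth_iter_par leq_subr. Qed.

Lemma below_depth_eq x y : below x y -> depth x = depth y -> x = y.
Proof. by move=> /eqP b e; move: b; rewrite e subnn. Qed.

Lemma below_par x y : y != root -> x != y -> below x y = below x (par y).
Proof.
move=> yr xy; rewrite /below; have [_ ->] := parP yr.
have [h|h] := leqP (depth x) (depth (par y)).
  by rewrite subSn // iterSr.
have -> : ((depth (par y)).+1 - depth x = 0)%N by lia.
have -> : (depth (par y) - depth x = 0)%N by lia.
rewrite /= eq_sym (negbTE xy); apply/esym/negP => /eqP e.
by move: h; rewrite e ltnn.
Qed.

Lemma below_trans x y z : below x y -> below y z -> below x z.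
Proof.
move=> xy yz; have := below_depth xy; have := below_depth yz.
move: xy yz; rewrite /below => /eqP <- /eqP <-.
rewrite !depth_iter_par -iterD => h1 h2.
have -> : (depth z - (depth z - (depth z - depth y) - (depth z - (depth z - depth y) - depth x)) = 
  depth z - (depth z - depth y) - depth x + (depth z - depth y))%N by lia.
by [].
Qed.

Lemma below_root x : below root x.
Proof.
by rewrite /below depth_root subn0 -depth_eq0 depth_iter_par subnn.
Qed.

Lemma par_below x : below (par x) x.
Proof.
have [->|xr] := eqVneq x root.
  by rewrite par_root belowxx.
by rewrite below_par ?belowxx //; apply/eqP => e; have [_] := parP xr; rewrite e; lia.
Qed.

Definition anc k x := iter (depth x - k) par x.

Lemma below_anc x y : below x y = (anc (depth x) y == x).
Proof. by []. Qed.

Lemma depth_anc k x : (k <= depth x)%N -> depth (anc k x) = k.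
Proof. by move=> kx; rewrite depth_iter_par subKn. Qed.

Lemma anc_below k x : below (anc k x) x.
Proof. by rewrite /below /anc depth_iter_par; apply/eqP; congr (iter _ _ _); lia. Qed.

Lemma anc_anc j k x : (j <= k)%N -> (k <= depth x)%N -> anc j (anc k x) = anc j x.
Proof.
move=> jk kx; rewrite /anc depth_iter_par -iterD; congr (iter _ _ _); lia.
Qed.

Lemma par_anc k x : (k < depth x)%N -> par (anc k.+1 x) = anc k x.
Proof. by move=> kx; rewrite /anc -(subnSK kx). Qed.

Lemma anc_depth x : anc (depth x) x = x. Proof. by rewrite /anc subnn. Qed.

Lemma below_cmp x y z : below x z -> below y z -> (depth x <= depth y)%N -> below x y.
Proof.
move=> /eqP xz /eqP yz h.
rewrite below_anc -yz anc_anc //; last exact/below_depth/eqP.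
by apply/eqP; exact: xz.
Qed.

(** ** Rays and edges *)

(** Injectivity forbids a ray to step back to the parent, so it descends. *)
Lemma ray_depth r : ray adj root r ->
  (forall n, depth (r n) = n) /\ (forall n, par (r n.+1) = r n).
Proof.
case=> r0 rS rI.
have pr n : depth (r n) = n -> depth (r n.+1) = n.+1 -> par (r n.+1) = r n.
  by move=> d d'; apply/esym/par_uniq; rewrite ?d ?d' // adjC.
have H n : depth (r n) = n /\ depth (r n.+1) = n.+1.
  elim: n => [|n [d d']]; split=> //; first by rewrite r0 depth_root.
    have := depth_adj (rS 0%N); rewrite {1}r0 depth_root => h.
    have : depth (r 1%N) != 0%N by rewrite depth_eq0 -r0; apply/eqP => /rI.
    lia.
  have := depth_adj (rS n.+1); rewrite d' leq_eqVlt => /orP[/eqP//|h].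
  have e : r n.+2 = r n by rewrite -(pr n d d'); apply: par_uniq; rewrite ?d'.
  by have := rI _ _ e; lia.
split=> n; first by case: (H n).
by case: (H n) => ? ?; exact: pr.

Qed.

Lemma ray_anc r n k : ray adj root r -> (k <= n)%N -> anc k (r n) = r k.
Proof.
move=> /ray_depth[rd rp] kn; rewrite /anc rd.
have -> : r k = r (n - (n - k))%N by congr r; lia.
move: (n - k)%N (leq_subr k n) => j; elim: j => [|j IH] jn /=; first by rewrite subn0.
rewrite IH 1?ltnW // -(rp (n - j.+1)%N); congr (par (r _)); lia.
Qed.

(** König's lemma.  The ray keeps to vertices that have a descendant in [A] at
    every level; local finiteness passes this property to some child. *)
Lemma koenig (A : pred V) : (forall x, x != root -> A x -> A (par x)) ->
  (forall n, exists x, A x /\ depth x = n) ->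
  exists r, ray adj root r /\ forall n, A (r n).
Proof.
move=> Apar Ainf.
pose good x := forall n, (depth x <= n)%N -> exists y, [/\ A y, depth y = n & below x y].
have step x : good x -> exists y, y \in kids x /\ good y.
  move=> gx; apply: contrapT => /forallNP H.
  have {}H y : exists n, y \in kids x -> (depth y <= n)%N /\ forall z, A z -> depth z = n -> ~~ below y z.
    have [yk|] := boolP (y \in kids x); last by exists 0%N.
    have /not_andP[//|] := H y; move=> /existsNP[n /not_implyP[dn nex]].
    exists n => _; split=> // z Az dz; apply/negP => yz.
    by apply: nex; exists z.
  have [f Hf] := choice H.
  (* a level beyond the finitely many levels at which the children fail *)
  pose M := (depth x).+1 + \sum_(y <- kids x) f y.
  have [z [Az dz xz]] := gx M ltac:(rewrite /M; lia).
  pose y := anc (depth x).+1 z.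
  have dy : depth y = (depth x).+1 by rewrite depth_anc // dz /M; lia.
  have yk : y \in kids x.
    rewrite mem_kids -depth_eq0 dy /= /y par_anc; last by rewrite dz /M; lia.
    exact: xz.
  have [h1 h2] := Hf y yk.
  have fM : (f y <= M)%N.
    rewrite /M (big_rem y) //=; lia.
  have Aanc k w : A w -> A (iter k par w).
    move=> Aw; elim: k => //= k IHk.
    have [e|ne] := eqVneq (iter k par w) root; last exact: Apar.
    by rewrite e par_root -e.
  have := h2 (anc (f y) z); rewrite depth_anc ?dz // => /(_ (Aanc _ _ Az) erefl)/negP; apply.
  by rewrite below_anc anc_anc ?dz // dy.
have groot : good root.
  by move=> n _; have [x [Ax dx]] := Ainf n; exists x; split => //; exact: below_root.
have [f Hf] : exists f : V -> V, forall x, good x -> f x \in kids x /\ good (f x).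
  have H x : exists y, good x -> y \in kids x /\ good y.
    have [/step[y Hy]|ng] := pselect (good x); first by exists y.
    by exists x.
  by have [f Hf] := choice H; exists f.
pose r n := iter n f root.
have gr n : good (r n) by elim: n => //= n /Hf[].
have rk n : r n.+1 \in kids (r n) by have [] := Hf _ (gr n).
have rd n : depth (r n) = n.
  by elim: n => [|n IH]; [exact: depth_root|rewrite (kids_depth (rk n)) IH].
exists r; split.
  split=> [//|n|m n e].
    by have := rk n; rewrite mem_filter mem_nb => /andP[].
  by rewrite -(rd m) e rd.
move=> n; have [y [Ay dy]] := gr n n ltac:(by rewrite rd).
by move=> /below_depth_eq; rewrite rd dy => /(_ erefl) ->.
Qed.

Definition edge x : {fset V} := [fset par x; x]%fset.

Lemma edge_edges x : x != root -> edges adj (edge x).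
Proof. by move=> /parP[xp _]; exists (par x), x; rewrite adjC. Qed.

Lemma edge_inj x y : x != root -> y != root -> edge x = edge y -> x = y.
Proof.
move=> /parP[_ dx] /parP[_ dy] /fsetP e.
have := e x; rewrite !in_fset2 eqxx orbT => /esym/orP[/eqP xy|/eqP//].
have := e y; rewrite !in_fset2 eqxx orbT => /orP[/eqP yx|/eqP//].
by move: dx dy; rewrite -yx -xy; lia.
Qed.

Lemma edge_depth_edge x : x != root -> edge_depth adj root (edge x) = depth x.
Proof.
move=> xr; rewrite /edge_depth; have [_ dx] := parP xr.
apply/eqP; rewrite eqn_leq; apply/andP; split.
  by apply/bigmax_leqP_seq => y; rewrite in_fset2 => /orP[]/eqP -> _; lia.
by apply: (leq_bigmax_seq (F := depth)); rewrite // in_fset2 eqxx orbT.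
Qed.

End Tree.

(** * Walks and their return probabilities *)

Section Walk.
Variables (V : choiceType) (adj : rel V) (root : V).
Hypothesis htree : is_tree adj.
Hypothesis hlf : locally_finite adj.
Hypothesis hinf : infinite_set [set: V].
Variables (R : realType) (c : {fset V} -> R).
Hypothesis hc : forall e, edges adj e -> 0 < c e.

Local Notation nb := (nb adj).

Definition cond x y := c [fset x; y]%fset.
Definition ctot x := \sum_(y <- nb x) cond x y.

Lemma ctotE x : ctot x = \sum_(y <- nb x) cond x y.
Proof. by []. Qed.

Lemma condC x y : cond x y = cond y x.
Proof. by rewrite /cond fsetUC. Qed.

Lemma cond_gt0 x y : adj x y -> 0 < cond x y.
Proof. by move=> xy; apply: hc; exists x, y. Qed.

Lemma ctot_gt0 x : 0 < ctot x.
Proof.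
rewrite /ctot; have := nb_neq0 htree hlf hinf x; case E : (nb x) => [//|a s] _.
have H y : y \in a :: s -> 0 < cond x y.
  by rewrite -E mem_nb // => /cond_gt0.
rewrite big_cons ltr_wpDr ?H ?mem_head // big_seq sumr_ge0 // => y ys.
by rewrite ltW // H // inE ys orbT.
Qed.

Local Notation p := (trans_prob adj c).

Lemma trans_probE x y : adj x y -> p x y = cond x y / ctot x.
Proof.
by move=> xy; rewrite /trans_prob xy fsbig_finite //; exact: hlf.
Qed.

Lemma trans_prob_ge0 x y : y \in nb x -> 0 <= p x y.
Proof.
rewrite mem_nb // => xy; rewrite trans_probE // divr_ge0 ?ltW ?cond_gt0 //.
exact: ctot_gt0.
Qed.

Lemma sum_trans_prob x : \sum_(y <- nb x) p x y = 1.
Proof.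
have -> : \sum_(y <- nb x) p x y = \sum_(y <- nb x) cond x y / ctot x.
  by apply: eq_big_seq => y; rewrite mem_nb // => xy; rewrite trans_probE.
by rewrite -mulr_suml divff // gt_eqF // ctot_gt0.
Qed.

(** The probability that the walk started at [x] avoids the root at the times
    1, ..., n. *)
Fixpoint noret n x : R :=
  if n is m.+1 then \sum_(y <- nb x | y != root) p x y * noret m y else 1.

Lemma noret_ge0 n x : 0 <= noret n x.
Proof.
elim: n x => //= n IH x; rewrite big_seq_cond sumr_ge0 // => y /andP[yx _].
by rewrite mulr_ge0 // trans_prob_ge0.
Qed.

Lemma noret_nincr n x : noret n.+1 x <= noret n x.
Proof.
elim: n x => [|n IH] x.
  rewrite /= -[leRHS](sum_trans_prob x) [leRHS](bigID (fun y => y != root)) /=.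
  under eq_bigr do rewrite mulr1.
  rewrite lerDl big_seq_cond sumr_ge0 // => y /andP[yx _]; exact: trans_prob_ge0.
rewrite /= big_seq_cond [leRHS]big_seq_cond; apply: ler_sum => y /andP[yx _].
by rewrite ler_wpM2l ?trans_prob_ge0 //; exact: IH.
Qed.

Lemma noret_le1 n x : noret n x <= 1.
Proof. by elim: n => // n IH; apply: le_trans (noret_nincr _ _) IH. Qed.

Section Bridge.
Variables (d : measure_display) (T : measurableType d) (Q : probability T R).
Variable X : nat -> T -> V.
Hypothesis hX : random_walk adj root c Q X.

Let mX n x : measurable [set w | X n w = x].
Proof. by case: hX. Qed.

(** The state space carries no measurable structure, so laws of the walk are
    decomposed over finitely many states plus a remainder. *)
Lemma split_state (s : seq V) k (E : set T) : uniq s -> measurable E ->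
  measurable (E `&` [set w | X k w \notin s]) /\
  (Q E = \sum_(y <- s) Q (E `&` [set w | X k w = y]) +
    Q (E `&` [set w | X k w \notin s]))%E.
Proof.
move=> us mE; elim: s us => [|a s IH] /=.
  move=> _; have -> : [set w | X k w \notin [::]] = setT by apply/seteqP.
  by rewrite setIT big_nil add0e.
move=> /andP[as_ us]; have [mEs ->] := IH us.
have e1 : E `&` [set w | X k w \notin a :: s] =
    (E `&` [set w | X k w \notin s]) `\` [set w | X k w = a].
  apply/seteqP; split=> w /=.
    by rewrite inE negb_or => -[Ew /andP[/eqP]].
  by move=> [[Ew ws] /eqP wa]; rewrite inE negb_or wa.
have e2 : E `&` [set w | X k w = a] =
    (E `&` [set w | X k w \notin s]) `&` [set w | X k w = a].
  by apply/seteqP; split=> w /= => [[Ew e]|[[]]//]; rewrite e.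
split; first by rewrite e1; exact: measurableD.
rewrite big_cons e2 e1 -addeA addeCA; congr (_ + _)%E.
rewrite addeC; exact: measureDI.
Qed.

Definition cyl k (x : nat -> V) : set T :=
  [set w | forall i, (i <= k)%N -> X i w = x i].

Definition avoid k n : set T :=
  [set w | forall i, (k < i <= k + n)%N -> X i w <> root].

Lemma measurable_cyl k x : measurable (cyl k x).
Proof.
have -> : cyl k x = \bigcap_(i in `I_k.+1) [set w | X i w = x i].
  by apply/seteqP; split=> w H i /= => [ik|ik]; exact: H.
by apply: bigcap_measurable => //; exists 0%N.
Qed.

Lemma measurable_avoid k n : measurable (avoid k n).
Proof.
have -> : avoid k n = \bigcap_(i in [set i | (k < i <= k + n)%N]) ~` [set w | X i w = root].
  by apply/seteqP; split=> w H i /= => [ik|ik]; exact: H.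
by apply: bigcap_measurableType => i _; exact/measurableC.
Qed.

Lemma cyl_succ k (x : nat -> V) y :
  cyl k x `&` [set w | X k.+1 w = y] =
  cyl k.+1 (fun i => if (i <= k)%N then x i else y).
Proof.
apply/seteqP; split=> w /= => [[H e] i|H].
  rewrite leq_eqVlt ltnS => /orP[/eqP ->|ik]; first by rewrite ltnn.
  by rewrite ik; exact: H.
split=> [i ik|]; last by rewrite H // ltnn.
by rewrite H ?ik // leqW.
Qed.

(** The walk a.s. jumps to a neighbour: the transition probabilities to the
    finitely many neighbours already sum to one. *)
Lemma cyl_outside k x :
  (Q (cyl k x `&` [set w | X k.+1 w \notin nb (x k)]) = 0)%E.
Proof.
have [_ e] := split_state k.+1 (uniq_nb adj (x k)) (measurable_cyl k x).
have fQ : (Q (cyl k x) \is a fin_num)%E by exact: fin_num_measure (measurable_cyl _ _).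
have H y : (Q (cyl k x `&` [set w | X k.+1 w = y]) =
    Q (cyl k x) * (p (x k) y)%:E)%E.
  rewrite cyl_succ; case: hX => _ _ ->; rewrite leqnn ltnn.
  by congr (Q _ * _)%E; apply/seteqP; split=> w h i ik; rewrite h // ik.
move: e; under eq_bigr do rewrite H.
rewrite -(fineK fQ); under eq_bigr do rewrite -EFinM.
rewrite sumEFin -mulr_sumr sum_trans_prob mulr1.
by case: (Q (_ `&` _)) => [r||] //= [] h; congr (_%:E); lra.
Qed.

(** The Markov property at time [k], by splitting on the next state. *)
Lemma cyl_avoid n k x :
  (Q (cyl k x `&` avoid k n) = Q (cyl k x) * (noret n (x k))%:E)%E.
Proof.
elim: n k x => [|n IH] k x.
  rewrite mule1; congr (Q _); apply/seteqP; split=> w /= => [[]//|h].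
  by split=> // i; rewrite addn0; lia.
have mE : measurable (cyl k x `&` avoid k n.+1).
  by apply: measurableI; [exact: measurable_cyl|exact: measurable_avoid].
have [mO ->] := split_state k.+1 (uniq_nb adj (x k)) mE.
rewrite [X in (_ + X)%E](_ : _ = 0%E) ?adde0; last first.
  apply/eqP; rewrite eq_le measure_ge0 andbT -(cyl_outside k x).
  apply: le_measure; rewrite ?inE //.
    by have [] := split_state k.+1 (uniq_nb adj (x k)) (measurable_cyl k x).
  by move=> w [[]].
have fQ : (Q (cyl k x) \is a fin_num)%E by exact: fin_num_measure (measurable_cyl _ _).
rewrite (bigID (fun y => y != root)) /= [X in (_ + X)%E]big1 ?adde0; last first.
  move=> y; rewrite negbK => /eqP ->; rewrite -(measure0 Q); congr (Q _).
  by apply/seteqP; split=> w //= [[_ h] e]; apply: (h k.+1) => //; lia.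
rewrite -(fineK fQ) -EFinM mulr_sumr -sumEFin; apply: eq_bigr => y yr.
rewrite mulrA EFinM EFinM (fineK fQ).
have := IH k.+1 (fun i => if (i <= k)%N then x i else y); rewrite ltnn => e.
transitivity (Q (cyl k.+1 (fun i => if (i <= k)%N then x i else y) `&` avoid k.+1 n)).
  rewrite -cyl_succ; congr (Q _); apply/seteqP; split=> w /=.
    move=> [[h1 h2] h3]; split=> // i; rewrite addSn => ik; apply: h2; lia.
  move=> [[h1 h3] h2]; split=> //; split=> // i ik.
  have [ei|ne] := eqVneq i k.+1; first by rewrite ei h3; exact/eqP.
  by apply: h2; lia.
rewrite e; congr (_ * _)%E.
case: hX => _ _ ->; rewrite leqnn ltnn.
by congr (Q _ * _)%E; apply/seteqP; split=> w h i ik; rewrite h // ik.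
Qed.

Lemma walk_noret n : Q (avoid 0 n) = (noret n root)%:E.
Proof.
have Q0 : Q (cyl 0 (fun=> root)) = 1%E.
  case: hX => _ <- _; congr (Q _); apply/seteqP; split=> w /= h; first exact: h.
  by move=> i; rewrite leqn0 => /eqP ->.
have := cyl_avoid n 0 (fun=> root); rewrite Q0 mul1e => <-.
have mc := measurable_cyl 0 (fun=> root); have ma := measurable_avoid 0 n.
have /= := measureDI Q ma mc; rewrite setIC [X in (X + _)%E](_ : _ = 0%E) ?add0e //.
apply/eqP; rewrite eq_le measure_ge0 andbT.
have : Q (~` cyl 0 (fun=> root)) = 0%E.
  by rewrite probability_setC // Q0 subee.
move=> <-; apply: le_measure; rewrite ?inE; first exact: measurableD.
  exact: measurableC.
by move=> w [].
Qed.

Lemma measurable_returns : measurable (returns_to_root root X).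
Proof.
have -> : returns_to_root root X = \bigcup_n ~` avoid 0 n.
  apply/seteqP; split=> w /= => [[n n0 e]|[n _ /existsNP[i]]].
    by exists n => // /(_ n); apply => //; lia.
  by move=> /not_implyP[i0 /contrapT e]; exists i => //; lia.
by apply: bigcup_measurable => n _; exact/measurableC/measurable_avoid.
Qed.

Lemma transient_of_noret (b : R) : 0 < b -> (forall n, b <= noret n root) ->
  transient root Q X.
Proof.
move=> b0 hb; rewrite /transient.
have -> : returns_to_root root X = ~` \bigcap_n avoid 0 n.
  apply/seteqP; split=> w /= => [[n n0 e] /(_ n I) /(_ n)|].
    by apply => //; lia.
  move=> /existsNP[n /not_implyP[_ /existsNP[i /not_implyP[i0 /contrapT e]]]].
  by exists i => //; lia.
have ma n := measurable_avoid 0 n.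
have mI : measurable (\bigcap_n avoid 0 n) by by apply: bigcap_measurable => //; exists 0%N.
have cv : Q (avoid 0 n) @[n --> \oo] --> Q (\bigcap_n avoid 0 n).
  apply: nonincreasing_cvg_mu => //.
    by rewrite -ge0_fin_numE ?fin_num_measure.
  move=> m n mn; apply/subsetPset => w /= h i im; apply: h; lia.
rewrite probability_setC //.
have : (b%:E <= Q (\bigcap_n avoid 0 n))%E.
  rewrite -(cvg_lim _ cv) //; apply: lime_ge; first by apply/cvg_ex; eexists; exact: cv.
  by apply: nearW => n; rewrite walk_noret lee_fin.
have : (Q (\bigcap_n avoid 0 n) \is a fin_num)%E by exact: fin_num_measure.
case: (Q _) => //= r _; rewrite lee_fin => br.
by rewrite -EFinB lte_fin; lra.
Qed.

Lemma recurrent_of_noret :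
  (forall e : R, 0 < e -> exists n, noret n root <= e) -> recurrent root Q X.
Proof.
move=> h; rewrite /recurrent; apply/eqP.
rewrite eq_le probability_le1; last exact: measurable_returns.
have fin : (Q (returns_to_root root X) \is a fin_num)%E.
  by apply: fin_num_measure; exact: measurable_returns.
apply/lee_addgt0Pr => e e0; have [n hn] := h e e0.
have ma := measurable_avoid 0 n.
have : (Q (~` avoid 0 n) <= Q (returns_to_root root X))%E.
  apply: le_measure; rewrite ?inE; [exact: measurableC|exact: measurable_returns|].
  by move=> w /= /existsNP[i /not_implyP[i0 /contrapT e']]; exists i => //; lia.
rewrite probability_setC // walk_noret -EFinB.
rewrite -(fineK fin) -EFinD !lee_fin; lra.
Qed.

End Bridge.
End Walk.

(** * Electrical bounds on the escape probability *)

Lemma ler_sum_subseq (R : numDomainType) (I : eqType) (s t : seq I) (f : I -> R) :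
  uniq s -> {subset s <= t} -> (forall i, i \in t -> 0 <= f i) ->
  \sum_(i <- s) f i <= \sum_(i <- t) f i.
Proof.
elim: s t => [|a s IH] t /=.
  by move=> _ _ f0; rewrite big_nil big_seq sumr_ge0.
move=> /andP[as_ us] st f0; have at_ : a \in t by apply: st; rewrite mem_head.
rewrite big_cons (big_rem a at_) /= lerD2l; apply: IH => //.
  move=> i i_s; have it : i \in t by apply: st; rewrite inE i_s orbT.
  move: it; rewrite (perm_mem (perm_to_rem at_)) inE => /orP[/eqP e|//].
  by rewrite -e i_s in as_.
by move=> i /mem_rem; exact: f0.
Qed.

Section Potential.
Variables (V : choiceType) (adj : rel V) (root : V).
Hypothesis htree : is_tree adj.
Hypothesis hlf : locally_finite adj.
Hypothesis hinf : infinite_set [set: V].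
Variables (R : realType) (c : {fset V} -> R).
Hypothesis hc : forall e, edges adj e -> 0 < c e.

Local Notation nb := (nb adj).
Local Notation depth := (depth adj root).
Local Notation par := (par adj root).
Local Notation kids := (kids adj root).
Local Notation lev := (lev adj root).
Local Notation anc := (anc adj root).
Local Notation below := (below adj root).
Local Notation edge := (edge adj root).
Local Notation cond := (cond c).
Local Notation ctot := (ctot adj c).
Local Notation noret := (noret adj root c).
Local Notation p := (trans_prob adj c).

Definition noret_lim x : R := limn (fun n => noret n x).

Lemma cvg_noret x : noret n x @[n --> \oo] --> noret_lim x.
Proof.
apply: nonincreasing_is_cvgn.
  by apply/nonincreasing_seqP => n; exact: noret_nincr.
by exists 0 => _ [n _ <-]; exact: noret_ge0.
Qed.

Lemma noret_lim_ge0 x : 0 <= noret_lim x.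
Proof.
apply: limr_ge; first by apply/cvg_ex; eexists; exact: cvg_noret.
by apply: nearW => n; exact: noret_ge0.
Qed.

Lemma noret_lim_le1 x : noret_lim x <= 1.
Proof.
apply: limr_le; first by apply/cvg_ex; eexists; exact: cvg_noret.
by apply: nearW => n; exact: noret_le1.
Qed.

Lemma noret_lim_step x :
  noret_lim x = \sum_(y <- nb x | y != root) p x y * noret_lim y.
Proof.
have h1 : noret n.+1 x @[n --> \oo] --> noret_lim x.
  by rewrite (cvg_shiftS (fun n => noret n x)); exact: cvg_noret.
apply: (cvg_unique _ h1) => //.
apply: cvg_big => [|y _]; first exact: add_continuous.
by apply: cvgM; [exact: cvg_cst|exact: cvg_noret].
Qed.

Lemma noret_lim_near (e : R) : 0 < e -> exists n, noret n root <= noret_lim root + e.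
Proof.
move=> e0; have /cvgrPdist_le /(_ e e0) [n _ H] := @cvg_noret root.
exists n; have := H n (leqnn n); rewrite ler_norml => /andP[h1 h2].
by move: h1; rewrite /= => h1; lra.
Qed.

(** The escape function [u] (zero at the root) is harmonic off the root, so the
    net current out of the root leaves [A] through its boundary edges; currents
    inside [A] cancel by antisymmetry, and each boundary edge carries at most
    its conductance since [0 <= u <= 1]. *)
Lemma nash_williams (A : seq V) : uniq A -> root \in A ->
  ctot root * noret_lim root <= \sum_(x <- A) \sum_(y <- nb x | y \notin A) cond x y.
Proof.
move=> uA rA; pose u y := if y == root then 0 else noret_lim y.
have u01 y : 0 <= u y <= 1.
  by rewrite /u; case: ifP; rewrite ?lexx ?ler01 // noret_lim_ge0 noret_lim_le1.
pose D x y := cond x y * (u y - u x).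
have E x : \sum_(y <- nb x) cond x y * u y = ctot x * noret_lim x.
  rewrite noret_lim_step (bigID (fun y => y == root)) /= big1 ?add0r; last first.
    by move=> y /eqP ->; rewrite /u eqxx mulr0.
  rewrite mulr_sumr big_seq_cond [RHS]big_seq_cond; apply: eq_bigr => y /andP[yx yr].
  rewrite trans_probE //; last by rewrite -mem_nb.
  rewrite /u (negbTE yr) mulrA; congr (_ * _).
  by rewrite mulrCA divff ?mulr1 // gt_eqF // ctot_gt0.
have ED x : \sum_(y <- nb x) D x y = if x == root then ctot root * noret_lim root else 0.
  rewrite /D; under eq_bigr do rewrite mulrBr.
  rewrite sumrB E -mulr_suml -/(ctot x) /u; case: eqP => [->|_]; first by rewrite mulr0 subr0.
  by rewrite subrr.
have tot : \sum_(x <- A) \sum_(y <- nb x) D x y = ctot root * noret_lim root.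
  rewrite (bigD1_seq root) //= ED eqxx big1 ?addr0 // => x xr.
  by rewrite ED (negbTE xr).
have inner : \sum_(x <- A) \sum_(y <- nb x | y \in A) D x y = 0.
  have e1 x : \sum_(y <- nb x | y \in A) D x y = \sum_(y <- A | adj x y) D x y.
    rewrite -big_filter -[RHS]big_filter; apply: perm_big; apply: uniq_perm.
    - exact/filter_uniq/uniq_nb.
    - exact/filter_uniq.
    - by move=> y; rewrite !mem_filter mem_nb // andbC.
  under eq_bigr do rewrite e1.
  (* exchanging the two summations changes the sign of every current *)
  set S := (LHS); have : S = - S; last by move=> h; lra.
  rewrite {1}/S (exchange_big_dep xpredT) //= -sumrN; apply: eq_bigr => x _.
  rewrite -sumrN; apply: eq_big => [y|y _]; first by case: htree => -[->].
  by rewrite /D condC; ring.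
have -> : ctot root * noret_lim root = \sum_(x <- A) \sum_(y <- nb x | y \notin A) D x y.
  have : \sum_(x <- A) \sum_(y <- nb x) D x y = \sum_(x <- A) \sum_(y <- nb x | y \in A) D x y
      + \sum_(x <- A) \sum_(y <- nb x | y \notin A) D x y.
    rewrite -big_split /=; apply: eq_bigr => x _.
    by rewrite [LHS](bigID (fun y => y \in A)).
  by rewrite inner add0r tot.
apply: ler_sum => x _; rewrite big_seq_cond [leRHS]big_seq_cond.
apply: ler_sum => y /andP[yx _]; rewrite /D ler_piMr //.
  by rewrite ltW // (cond_gt0 hc) // -mem_nb.
by have := u01 x; have := u01 y; lra.
Qed.

Lemma cond_edge y : cond (par y) y = c (edge y). Proof. by []. Qed.

(** Whether the path from the root to [v] uses an edge marked by [F], an edge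
    being marked at its lower endpoint. *)
Definition hit (F : pred V) v := has (fun k => F (anc k.+1 v)) (iota 0 (depth v)).

Lemma hitP (F : pred V) v : reflect (exists x, [/\ x != root, below x v & F x]) (hit F v).
Proof.
apply: (iffP hasP) => [[k]|[x [xr xv Fx]]].
  rewrite mem_iota /= add0n => kv Fk; exists (anc k.+1 v); split=> //.
    by rewrite -(depth_eq0 _ htree) depth_anc.
  exact: anc_below.
have dv := below_depth htree xv; have : depth x != 0%N by rewrite depth_eq0.
move=> d0; exists (depth x).-1; first by rewrite mem_iota; lia.
by rewrite prednK ?lt0n //; move: xv; rewrite below_anc => /eqP ->.
Qed.

(** Nash-Williams for the component [A] of the root off the marked edges, when
    each marked edge is charged to a vertex of [S] below it.  Two boundary edges
    of [A] are never one above the other, so they are charged to distinct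
    vertices. *)
Lemma cut_noret (N : nat) (F : pred V) (S : seq V) (b : V -> R) :
  (forall e, e \in S -> 0 <= b e) ->
  (forall v, depth v = N -> hit F v) ->
  (forall y, y != root -> F y -> exists e, [/\ e \in S, below y e & c (edge y) <= b e]) ->
  ctot root * noret_lim root <= \sum_(e <- S) b e.
Proof.
move=> b0 hN hF.
pose A := [seq v <- flatten [seq lev k | k <- iota 0 N.+1] | ~~ hit F v].
have flatE n v : (v \in flatten [seq lev k | k <- iota 0 n]) = (depth v < n)%N.
  apply/flattenP/idP => [[_ /mapP[k kN ->]]|dv].
    by rewrite mem_lev // => /eqP ->; move: kN; rewrite mem_iota.
  exists (lev (depth v)); last by rewrite mem_lev.
  by apply/map_f; rewrite mem_iota.
have flatU n : uniq (flatten [seq lev k | k <- iota 0 n]).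
  elim: n => // n IH; rewrite -addn1 iotaD map_cat flatten_cat cat_uniq IH /=.
  rewrite cats0 uniq_lev // andbT; apply/hasPn => v; rewrite flatE mem_lev //.
  by rewrite add0n => /eqP ->; rewrite ltnn.
have mA v : (v \in A) = ~~ hit F v.
  rewrite mem_filter flatE; have [//|nh] /= := boolP (hit F v).
  rewrite ltnS leqNgt; apply/negP => h.
  have := hN (anc N v); rewrite depth_anc ?(ltnW h) // => /(_ erefl) /hitP[x [xr xv Fx]].
  move/negP: nh; apply; apply/hitP; exists x; split=> //.
  by apply: below_trans xv _ => //; exact: anc_below.
have uA : uniq A by exact: filter_uniq.
have rA : root \in A by rewrite mA /hit depth_root.
apply: le_trans (nash_williams uA rA) _.
have bd x y : x \in A -> y \in nb x -> y \notin A -> (y \in kids x) && F y.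
  rewrite !mA negbK mem_nb // => nx xy /hitP[z [zr zy Fz]].
  have key : z = y -> (y \in kids x) && F y.
    move=> e; subst z; rewrite Fz andbT mem_kids // zr /=.
    have [dy|dy] := leqP (depth y) (depth x).
      move/negP: nx; case; apply/hitP; exists y; split=> //.
      by rewrite (par_uniq htree xy dy) par_below.
    apply/eqP/esym/par_uniq => //; last exact: ltnW.
    by case: htree => -[->].
  have [/key //|zny] := eqVneq z y.
  move/negP: nx; case; apply/hitP; exists z; split=> //.
  have [dy|dy] := leqP (depth y) (depth x).
    apply: below_trans zy _ => //; by rewrite (par_uniq htree xy dy) par_below.
  have yr : y != root by rewrite -(depth_eq0 _ htree); lia.
  rewrite below_par // in zy; suff -> : x = par y by [].
  by apply: par_uniq; [|case: htree => -[->]|exact: ltnW].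
pose B := flatten [seq [seq y <- kids x | F y] | x <- A].
have mB y : (y \in B) = [&& y != root, F y & ~~ hit F (par y)].
  apply/flattenP/idP => [[_ /mapP[x xA ->]]|/and3P[yr Fy hy]].
    by rewrite mem_filter mem_kids // => /and3P[-> -> /eqP ->]; rewrite -mA.
  exists [seq z <- kids (par y) | F z]; last by rewrite mem_filter Fy mem_kids // yr eqxx.
  by apply/mapP; exists (par y); rewrite ?mA.
have uB : uniq B.
  rewrite /B; elim: A uA {mA rA bd mB B} => //= x s IH /andP[xs us].
  rewrite cat_uniq filter_uniq ?uniq_kids //= IH // andbT.
  apply/hasPn => y /flattenP[_ /mapP[z zs ->]].
  rewrite !(@mem_filter _ F) !mem_kids // => /and3P[-> -> /eqP ->] /=.
  by apply: contra xs => /eqP <-.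
apply: (@le_trans _ _ (\sum_(y <- B) c (edge y))).
  rewrite big_flatten big_map big_seq [leRHS]big_seq; apply: ler_sum => x xA.
  rewrite -[leLHS]big_filter.
  apply: (@le_trans _ _ (\sum_(y <- [seq y <- kids x | F y]) cond x y)).
    apply: ler_sum_subseq; first exact/filter_uniq/uniq_nb.
      move=> y; rewrite mem_filter => /andP[yA yx].
      by rewrite mem_filter andbC; exact: bd.
    move=> y; rewrite mem_filter => /andP[_]; rewrite mem_filter => /andP[_ yx].
    by rewrite ltW // (cond_gt0 hc) // -mem_nb.
  rewrite big_seq [leRHS]big_seq; apply: ler_sum => y.
  by rewrite mem_filter mem_kids // => /and3P[_ _ /eqP <-].
have H y : exists e, y \in B -> [/\ e \in S, below y e & c (edge y) <= b e].
  have [yB|_] := boolP (y \in B); last by exists y.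
  move: yB; rewrite mB => /and3P[yr Fy _]; have [e he] := hF _ yr Fy.
  by exists e.
have [g hg] := choice H.
apply: (@le_trans _ _ (\sum_(y <- B) b (g y))).
  by rewrite big_seq [leRHS]big_seq; apply: ler_sum => y /hg[].
rewrite -(big_map g xpredT b); apply: ler_sum_subseq => //.
  rewrite map_inj_in_uniq // => y z yB zB e.
  have [_ by_ _] := hg y yB; have [_ bz _] := hg z zB; rewrite -e in bz.
  have wl s t : s \in B -> t \in B -> below s (g y) -> below t (g y) ->
      (depth s <= depth t)%N -> s = t.
    move=> sB tB sy ty st; have b1 := below_cmp htree sy ty st.
    have [//|ne] := eqVneq s t; move: sB tB; rewrite !mB => /and3P[sr Fs _] /and3P[tr Ft].
    by case/negP; apply/hitP; exists s; split=> //; rewrite -below_par.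
  have [h|h] := leqP (depth y) (depth z); first exact: wl.
  by apply/esym/wl => //; exact: ltnW.
by move=> _ /mapP[y yB ->]; have [] := hg y yB.
Qed.

(** On a tree every edge function is a gradient: [pot f] is the potential of
    the current [f]. *)
Definition pot (f : V -> R) v := \sum_(0 <= k < depth v) f (anc k.+1 v) / c (edge (anc k.+1 v)).

Lemma pot_root f : pot f root = 0.
Proof. by rewrite /pot depth_root // big_nil. Qed.

Lemma pot_par f v : v != root -> pot f v = pot f (par v) + f v / c (edge v).
Proof.
move=> vr; have [_ dv] := parP htree vr.
rewrite /pot dv big_nat_recr //= -dv anc_depth; congr (_ + _).
rewrite big_nat_cond [RHS]big_nat_cond; apply: eq_bigr => k /andP[/andP[_ kd] _].
have e : par v = anc (depth (par v)) v.
  by rewrite -[in LHS](anc_depth adj root v) dv par_anc // dv.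
by rewrite e anc_anc // dv.
Qed.

(** Conservation of [f] is harmonicity of its potential, so the potential
    scaled to be at most one bounds [noret n] from below, by induction on [n],
    as long as the walk cannot have reached depth [N]. *)
Lemma pot_noret (N : nat) (f : V -> R) (D : R) : 0 < D ->
  (forall x, 0 <= f x) ->
  (forall x, (depth x < N)%N -> \sum_(y <- kids x) f y = f x) ->
  (forall v, (depth v <= N)%N -> pot f v <= D) ->
  forall n, (n <= N)%N -> f root / (ctot root * D) <= noret n root \/ n = 0%N.
Proof.
move=> D0 f0 fK fD.
have Dn : D != 0 by rewrite gt_eqF.
have ce y : y != root -> c (edge y) != 0 by move=> yr; rewrite gt_eqF // hc //; exact: edge_edges.
have kidsum x : (depth x < N)%N ->
    \sum_(y <- kids x) cond x y * pot f y = (\sum_(y <- kids x) cond x y) * pot f x + f x.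
  move=> xN; rewrite mulr_suml -(fK _ xN) -big_split /= big_seq [RHS]big_seq.
  apply: eq_bigr => y; rewrite mem_kids // => /andP[yr /eqP e].
  rewrite pot_par // e mulrDr; congr (_ + _).
  by rewrite -e cond_edge mulrCA divff ?mulr1 // ce.
have harm x : (depth x < N)%N -> \sum_(y <- nb x) p x y * pot f y =
    if x == root then f root / ctot root else pot f x.
  move=> xN; have cx : ctot x != 0 by rewrite gt_eqF // ctot_gt0.
  have -> : \sum_(y <- nb x) p x y * pot f y = (\sum_(y <- nb x) cond x y * pot f y) / ctot x.
    rewrite mulr_suml big_seq [RHS]big_seq; apply: eq_bigr => y yx.
    by rewrite trans_probE -?mem_nb // mulrAC.
  case: eqP => [e|/eqP xr].
    subst x; rewrite nb_root // kidsum // pot_root mulr0 add0r //.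
  have pm := nb_perm htree hlf xr.
  have ct : ctot x = cond x (par x) + \sum_(y <- kids x) cond x y.
    by rewrite ctotE (perm_big _ pm) big_cons.
  rewrite (perm_big _ pm) big_cons kidsum // (pot_par f xr).
  apply: (mulIf cx); rewrite divfK // ct condC cond_edge.
  move: (\sum_(y <- kids x) _) (pot f (par x)) (ce x xr) => A B cx0.
  by rewrite /=; field.
have main n x : (depth x + n <= N)%N -> pot f x / D <= noret n x.
  elim: n x => [|n IH] x xN.
    by rewrite ler_pdivrMr // mul1r fD //; lia.
  apply: (@le_trans _ _ (\sum_(y <- nb x) p x y * (pot f y / D))).
    under eq_bigr do rewrite mulrA.
    rewrite -mulr_suml harm; last lia.
    case: eqP => [->|//]; rewrite pot_root mul0r !divr_ge0 // ltW //.
    exact: ctot_gt0.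
  rewrite (bigID (fun y => y != root)) /= [X in _ + X]big1 ?addr0; last first.
    by move=> y; rewrite negbK => /eqP ->; rewrite pot_root mul0r mulr0.
  rewrite big_seq_cond [leRHS]big_seq_cond; apply: ler_sum => y /andP[yx _].
  rewrite ler_wpM2l ?trans_prob_ge0 // IH //.
  have := depth_adj root htree (x := x) (y := y); rewrite -mem_nb // => /(_ yx); lia.
case=> [|n] nN; [by right|left].
apply: (@le_trans _ _ (\sum_(y <- nb root) p root y * (pot f y / D))).
  under eq_bigr do rewrite mulrA.
  rewrite -mulr_suml harm ?depth_root ?eqxx // ?invfM ?mulrA //; lia.
rewrite (bigID (fun y => y != root)) /= [X in _ + X]big1 ?addr0; last first.
  by move=> y; rewrite negbK => /eqP ->; rewrite pot_root mul0r mulr0.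
rewrite big_seq_cond [leRHS]big_seq_cond; apply: ler_sum => y /andP[yx _].
rewrite ler_wpM2l ?trans_prob_ge0 // main //.
have := depth_adj root htree (x := root) (y := y); rewrite -mem_nb // => /(_ yx).
rewrite depth_root //; lia.
Qed.

Definition flow_of N (mu : V -> R) x := \sum_(l <- lev N | below x l) mu l.

Lemma flow_of_kids N mu x : (depth x < N)%N ->
  \sum_(y <- kids x) flow_of N mu y = flow_of N mu x.
Proof.
move=> xN; rewrite /flow_of; under eq_bigr do rewrite big_mkcond.
rewrite exchange_big /= [RHS]big_mkcond big_seq [RHS]big_seq; apply: eq_bigr => l.
rewrite mem_lev // => /eqP dl; case: ifPn => xl.
  set z := anc (depth x).+1 l.
  have dz : depth z = (depth x).+1 by rewrite depth_anc // dl.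
  have zk : z \in kids x.
    by rewrite mem_kids // -(depth_eq0 _ htree) dz /= par_anc ?dl // -below_anc.
  rewrite (bigD1_seq z) ?uniq_kids //= anc_below // big1_seq ?addr0 // => y /andP[yz yk].
  case: ifPn => // yl; move: yl yz; rewrite below_anc (kids_depth yk) -/z => /eqP ->.
  by rewrite eqxx.
rewrite big1_seq // => y /andP[_ yk]; case: ifPn => // yl.
move/negP: xl; case; apply: below_trans yl => //.
by move: yk; rewrite mem_kids // => /andP[_ /eqP <-]; exact: par_below.
Qed.

(** [sum mu l * H l] is the energy of the flow below depth [m].  By Markov's
    inequality the leaves with [H l > 1] carry mass at most 1/4, so that a mass
    of at least 1/4 remains once they are removed; the potential of the pruned
    flow is then bounded everywhere, since it only grows along edges that still
    lead to a remaining leaf. *)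
Lemma good_noret (m N : nat) (kap : R) (mu : V -> R) (K : nat -> R) :
  (m <= N)%N -> 0 < kap ->
  (forall x, x != root -> (depth x <= m)%N -> kap <= c (edge x)) ->
  (forall l, 0 <= mu l) -> (forall k, 0 <= K k) ->
  (forall l x, depth l = N -> mu l != 0 -> x != root -> below x l -> (m < depth x)%N ->
     (c (edge x))^-1 <= K (depth x)) ->
  2^-1 <= \sum_(l <- lev N) mu l ->
  \sum_(l <- lev N) mu l * (\sum_(m <= k < N) K k.+1 * flow_of N mu (anc k.+1 l)) <= 4^-1 ->
  forall n, (n <= N)%N -> (ctot root * (m%:R / kap + 4))^-1 <= noret n root \/ n = 0%N.
Proof.
move=> mN k0 hk mu0 K0 hK S2.
set H := fun l => \sum_(m <= k < N) K k.+1 * flow_of N mu (anc k.+1 l).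
rewrite -/(H _) => hE n nN.
have fl0 x : 0 <= flow_of N mu x by apply: sumr_ge0.
have H0 l : 0 <= H l by apply: sumr_ge0 => k _; rewrite mulr_ge0.
pose mu' l := if H l <= 1 then mu l else 0.
have mu'0 l : 0 <= mu' l by rewrite /mu'; case: ifP.
have mu'le l : mu' l <= mu l by rewrite /mu'; case: ifP.
set f := flow_of N mu'.
have f0 x : 0 <= f x by apply: sumr_ge0.
have fle x : f x <= flow_of N mu x by apply: ler_sum => l _.
set S := \sum_(l <- lev N) mu' l.
have fS x : f x <= S.
  rewrite /f /flow_of big_mkcond; apply: ler_sum => l _; by case: ifP.
have froot : f root = S.
  by rewrite /f /flow_of; apply: eq_bigl => l; exact: below_root.
have S4 : 4^-1 <= S.
  have : \sum_(l <- lev N) mu l - S <= 4^-1.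
    rewrite -sumrB; apply: le_trans hE; apply: ler_sum => l _.
    rewrite /mu' -/(H l); case: ifPn => [_|]; first by rewrite subrr mulr_ge0.
    by rewrite -ltNge => h; rewrite subr0 ler_peMr // ltW.
  by move: S2; lra.
have mk0 : 0 <= m%:R / kap by rewrite divr_ge0 // ltW.
set D := S * (m%:R / kap) + 1.
have D0 : 0 < D by rewrite /D ltr_wpDl // mulr_ge0 //; lra.
have cpos x : x != root -> 0 < c (edge x) by move=> xr; apply: hc; exact: edge_edges.
have fD v : (depth v <= N)%N -> pot f v <= D.
  have [j] := ubnP (depth v); elim: j v => // j IH v vj vN.
  have [->|vr] := eqVneq v root; first by rewrite pot_root ltW.
  have [_ dv] := parP htree vr.
  have [f_v|f_v] := eqVneq (f v) 0.
    by rewrite pot_par // f_v mul0r addr0 IH //; lia.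
  have [l [lN vl mul]] : exists l, [/\ depth l = N, below v l & mu' l != 0].
    apply: contrapT => /forallNP hn; move/eqP: f_v; apply.
    rewrite /f /flow_of big_seq_cond big1 // => l /andP[lN vl].
    apply/eqP/negPn/negP => e; apply: (hn l); split => //.
    by move: lN; rewrite mem_lev // => /eqP.
  have Hl : H l <= 1 by move: mul; rewrite /mu'; case: ifP => //; rewrite eqxx.
  have mul0 : mu l != 0 by move: mul; rewrite /mu' Hl.
  (* bounds on the potential drops: [kap] controls the edges above depth [m],
     openness those below *)
  pose t k := if (k < m)%N then S / kap else K k.+1 * flow_of N mu (anc k.+1 l).
  have t0 k : 0 <= t k.
    rewrite /t; case: ifP => _; last by rewrite mulr_ge0.
    by rewrite divr_ge0 ?(ltW k0) //; lra.
  apply: (@le_trans _ _ (\sum_(0 <= k < depth v) t k)).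
    rewrite /pot big_nat_cond [leRHS]big_nat_cond; apply: ler_sum => k /andP[/andP[_ kv] _].
    have av : anc k.+1 v = anc k.+1 l.
      by move: vl; rewrite below_anc => /eqP <-; rewrite anc_anc ?lN ?depth_anc ?lN.
    have ar : anc k.+1 v != root by rewrite -(depth_eq0 _ htree) depth_anc.
    rewrite /t; case: ltnP => km.
      apply: ler_pM => //; first by rewrite invr_ge0 ltW // cpos.
      by rewrite lef_pV2 ?posrE ?cpos // hk // depth_anc.
    rewrite mulrC; apply: ler_pM => //; first by rewrite invr_ge0 ltW // cpos.
      have := @hK l (anc k.+1 v) lN mul0 ar; rewrite depth_anc // => -> //.
      by rewrite av anc_below.
    by rewrite av.
  apply: (@le_trans _ _ (\sum_(0 <= k < N) t k)).
    rewrite [leRHS](big_cat_nat _ vN) //= lerDl; exact: sumr_ge0.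
  rewrite (big_cat_nat _ mN) //=; apply: lerD.
    rewrite (eq_big_nat _ _ (F2 := fun=> S / kap)); last by move=> k /andP[_ km]; rewrite /t km.
    rewrite sumr_const_nat subn0 -[leLHS]mulr_natr le_eqVlt; apply/orP; left.
    by apply/eqP; rewrite mulrAC mulrA.
  apply: le_trans Hl; rewrite le_eqVlt; apply/orP; left; apply/eqP.
  by apply: eq_big_nat => k /andP[km _]; rewrite /t ltnNge km.
have [h|->] := pot_noret D0 f0 (fun x => @flow_of_kids N mu' x) fD nN; last by right.
left; apply: le_trans h; rewrite froot.
have ct := ctot_gt0 htree hlf hinf hc root.
have S0 : 0 < S by lra.
have -> : S / (ctot root * D) = (ctot root * (m%:R / kap + S^-1))^-1.
  rewrite /D; field; rewrite ?gt_eqF //=.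
  have : 0 <= S * m%:R by rewrite mulr_ge0 // ltW. 
  by move=> ?; lra.
have iS : S^-1 <= 4.
  by rewrite -[leRHS]invrK lef_pV2 ?posrE // invr_gt0.
have iS0 : 0 < S^-1 by rewrite invr_gt0.
rewrite lef_pV2 ?posrE ?mulr_gt0 //; [|lra|lra].
by apply: ler_wpM2l; [exact: ltW|rewrite lerD2l].
Qed.

End Potential.

(** * Cutsets and flows *)

Section Cutsets.
Variables (V : choiceType) (adj : rel V) (root : V).
Hypothesis htree : is_tree adj.
Hypothesis hlf : locally_finite adj.
Variable R : realType.

Local Notation depth := (depth adj root).
Local Notation par := (par adj root).
Local Notation kids := (kids adj root).
Local Notation lev := (lev adj root).
Local Notation anc := (anc adj root).
Local Notation below := (below adj root).
Local Notation edge := (edge adj root).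
Local Notation hit := (hit adj root).

(** By König's lemma the edges of a cutset above some finite level already
    separate the root from infinity. *)
Lemma cutset_truncate (pi : set {fset V}) : cutset adj root pi ->
  exists N (S : seq V), [/\ uniq S, forall x, x \in S -> x != root /\ pi (edge x) &
    forall v, depth v = N -> exists2 x, x \in S & below x v].
Proof.
move=> [piE piR]; pose F x := `[< pi (edge x) >].
have : exists N, forall v, depth v = N -> hit F v.
  apply: contrapT => /forallNP hn.
  have [r [rr rF]] : exists r, ray adj root r /\ forall n, ~~ hit F (r n).
    apply: (koenig htree hlf (A := fun x => ~~ hit F x)).
      move=> x xr; apply: contra => /hitP; move=> /(_ htree)[y [yr yx Fy]].
      apply/hitP => //; exists y; split=> //; apply: below_trans yx _ => //.
      exact: par_below.
    move=> n; have /existsNP[v /not_implyP[dv hv]] := hn n.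
    by exists v; split=> //; exact/negP.
  have [e [[pe [k ek]] _]] := piR r rr.
  have [rd rp] := ray_depth htree rr.
  move/negP: (rF k.+1); apply; apply/hitP => //; exists (r k.+1); split.
  - by rewrite -(depth_eq0 _ htree) rd.
  - exact: belowxx.
  - by apply/asboolP; rewrite /edge rp -ek.
case=> N hN; exists N, (undup [seq x <- flatten [seq lev k | k <- iota 0 N.+1] | (x != root) && F x]).
split; first exact: undup_uniq.
  by move=> x; rewrite mem_undup mem_filter => /andP[/andP[xr /asboolP]].
move=> v dv; have /hitP := hN v dv; move=> /(_ htree)[x [xr xv Fx]].
exists x => //; rewrite mem_undup mem_filter xr Fx !andTb.
apply/flattenP; exists (lev (depth x)); last by rewrite mem_lev.
by apply/map_f; rewrite mem_iota /= ltnS -dv; exact: below_depth xv.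
Qed.

Lemma cutset_sum_ge (lam : R) (pi : set {fset V}) (S : seq V) : uniq S ->
  (forall x, x \in S -> x != root /\ pi (edge x)) ->
  ((\sum_(x <- S) expR (- ((depth x)%:R `^ lam)))%:E <= cutset_sum adj root lam pi)%E.
Proof.
move=> uS hS; apply: esum_ge.
have uE : uniq (map edge S).
  rewrite map_inj_in_uniq // => x y xS yS; apply: edge_inj => //.
    by have [] := hS x xS.
  by have [] := hS y yS.
exists [set` map edge S].
  split; first exact: finite_seq.
  by move=> _ /= /mapP[x xS ->]; have [] := hS x xS.
rewrite -fsbig_seq // big_map -sumEFin big_seq [leRHS]big_seq.
apply: lee_sum => x xS; rewrite edge_depth_edge //.
by have [] := hS x xS.
Qed.

Section MaxFlow.
Variable cap : nat -> R.
Hypothesis cap_ge0 : forall k, 0 <= cap k.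

(** The maximal flow through the edge above [v] and then down through [n] more
    generations; its recursion also exhibits the minimal cut. *)
Fixpoint maxflow n v : R :=
  if n is m.+1 then Num.min (cap (depth v)) (\sum_(y <- kids v) maxflow m y)
  else cap (depth v).

Fixpoint mincut n v : seq V :=
  if n is m.+1 then
    if cap (depth v) <= \sum_(y <- kids v) maxflow m y then [:: v]
    else flatten [seq mincut m y | y <- kids v]
  else [:: v].

Lemma maxflow_ge0 n v : 0 <= maxflow n v.
Proof.
elim: n v => //= n IH v; rewrite le_min cap_ge0 /=; apply: sumr_ge0 => y _; exact: IH.
Qed.

Lemma maxflow_cap n v : maxflow n v <= cap (depth v).
Proof. by case: n => //= n; rewrite ge_min lexx. Qed.

Lemma sum_mincut n v : \sum_(x <- mincut n v) cap (depth x) = maxflow n v.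
Proof.
elim: n v => [|n IH] v /=; first by rewrite big_seq1.
case: lerP => h; first by rewrite big_seq1.
by rewrite big_flatten big_map; apply: eq_bigr => y _.
Qed.

Lemma mincut_below n v x : x \in mincut n v -> below v x.
Proof.
elim: n v => [|n IH] v /=; first by rewrite inE => /eqP ->; exact: belowxx.
case: ifP => _; first by rewrite inE => /eqP ->; exact: belowxx.
move=> /flattenP[_ /mapP[y yk ->] /IH]; apply: below_trans => //.
by move: yk; rewrite mem_kids // => /andP[_ /eqP <-]; exact: par_below.
Qed.

Lemma ray_kid r k : ray adj root r -> r k.+1 \in kids (r k).
Proof.
move=> rr; have [rd rp] := ray_depth htree rr.
by rewrite mem_kids // -(depth_eq0 _ htree) rd rp /=.
Qed.

Lemma ray_kid_below r k y j : ray adj root r -> y \in kids (r k) ->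
  below y (r j) -> y = r k.+1.
Proof.
move=> rr yk yj; have [rd rp] := ray_depth htree rr.
have dy := kids_depth yk; rewrite rd in dy.
have := below_depth htree yj; rewrite dy rd => kj.
by move: yj; rewrite below_anc dy (ray_anc htree) // => /eqP ->.
Qed.

(** The cut stops either at [r k] itself or in exactly one child subtree of
    [r k] visited by the ray. *)
Lemma mincut_ray n r k : ray adj root r ->
  exists j, [/\ (k <= j)%N, r j \in mincut n (r k) &
    forall i, r i \in mincut n (r k) -> i = j].
Proof.
move=> rr; have [rd rp] := ray_depth htree rr.
have sing : exists j, [/\ (k <= j)%N, r j \in [:: r k] & forall i, r i \in [:: r k] -> i = j].
  exists k; split; rewrite ?mem_head // => i; rewrite inE => /eqP e.
  by rewrite -(rd i) e rd.
elim: n k sing => [|n IH] k sing //=; case: ifP => _ //.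
have [|j [kj rj uj]] := IH k.+1.
  exists k.+1; split; rewrite ?mem_head // => i; rewrite inE => /eqP e.
  by rewrite -(rd i) e rd.
exists j; split; first exact: ltnW.
  by apply/flattenP; exists (mincut n (r k.+1)) => //; apply/map_f/ray_kid.
move=> i /flattenP[_ /mapP[y yk ->] ry]; apply: uj.
by rewrite -(ray_kid_below rr yk (mincut_below ry)).
Qed.

Definition rootcut n := flatten [seq mincut n y | y <- kids root].
Definition rootflow n := \sum_(y <- kids root) maxflow n y.

Lemma rootcut_neq n x : x \in rootcut n -> x != root.
Proof.
move=> /flattenP[_ /mapP[y yk ->] /mincut_below yx].
rewrite -(depth_eq0 _ htree) -lt0n; apply: leq_trans (below_depth htree yx).
by rewrite (kids_depth yk).
Qed.

Lemma rootcut_cutset n : cutset adj root [set e | exists2 x, x \in rootcut n & e = edge x].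
Proof.
split=> [_ [x xc ->]|r rr]; first exact/edge_edges/(rootcut_neq xc).
have [rd rp] := ray_depth htree rr; have r0 : r 0%N = root by case: rr.
have [j [j0 rj uj]] := mincut_ray n 1 rr.
have k1 : r 1%N \in kids root by have := ray_kid 0 rr; rewrite r0.
exists (edge (r j)); split.
  split; first by exists (r j) => //; apply/flattenP; exists (mincut n (r 1%N)) => //; exact/map_f.
  by exists j.-1; rewrite /edge -{1}(prednK j0) rp prednK.
move=> e' [[x xc ->] [k ek]].
have xk : x = r k.+1.
  apply: (edge_inj (root := root) htree); rewrite ?(rootcut_neq xc) //.
    by rewrite -(depth_eq0 _ htree) rd.
  by rewrite ek /edge rp.
subst x; move: xc => /flattenP[_ /mapP[y yk ->] ry].
have yk0 : y \in kids (r 0%N) by rewrite r0.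
have e := ray_kid_below rr yk0 (mincut_below ry).
by rewrite e in ry; rewrite (uj _ ry).
Qed.

(** The flow of maximal strength towards level [N.+1] is obtained from the top:
    it splits among the children of a vertex in proportion to their maximal
    flows. *)
Definition subflow N x := maxflow (N.+1 - depth x) x.
Definition kidflow N x := \sum_(y <- kids x) subflow N y.

Fixpoint theta_rec N n v : R :=
  if n is m.+1 then theta_rec N m (par v) * (subflow N v / kidflow N (par v))
  else kidflow N root.

Definition theta N v := theta_rec N (depth v) v.

Lemma subflow_ge0 N x : 0 <= subflow N x. Proof. exact: maxflow_ge0. Qed.
Lemma kidflow_ge0 N x : 0 <= kidflow N x.
Proof. by apply: sumr_ge0 => y _; exact: subflow_ge0. Qed.

Lemma subflow_kidflow N x : (depth x <= N)%N -> subflow N x <= kidflow N x.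
Proof.
move=> xN; rewrite /subflow subSn //= ge_min; apply/orP; right.
rewrite /kidflow big_seq [leRHS]big_seq; apply: ler_sum => y yk.
by rewrite /subflow (kids_depth yk) subSS.
Qed.

Lemma kidflow_root N : kidflow N root = rootflow N.
Proof.
rewrite /kidflow /rootflow big_seq [RHS]big_seq; apply: eq_bigr => y yk.
by rewrite /subflow (kids_depth yk) depth_root // subSS subn0.
Qed.

Lemma theta_kid N x y : y \in kids x -> theta N y = theta N x * (subflow N y / kidflow N x).
Proof.
move=> yk; rewrite /theta (kids_depth yk) /=.
by move: yk; rewrite mem_kids // => /andP[_ /eqP ->].
Qed.

Lemma theta_ge0 N x : 0 <= theta N x.
Proof.
rewrite /theta; move En : (depth x) => n; elim: n x {En} => [|n IH] x /=; first exact: kidflow_ge0.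
by rewrite mulr_ge0 // divr_ge0 ?subflow_ge0 ?kidflow_ge0.
Qed.

Lemma theta_root N : theta N root = rootflow N.
Proof. by rewrite /theta depth_root //= kidflow_root. Qed.

(** What arrives at a vertex can be passed on to its children: it is at most
    the sum of their maximal flows. *)
Lemma theta_le N x : (depth x <= N.+1)%N ->
  ((depth x <= N)%N -> theta N x <= kidflow N x) /\ (x != root -> theta N x <= subflow N x).
Proof.
have [n] := ubnP (depth x); elim: n x => // n IH x xn xN.
have [->|xr] := eqVneq x root.
  by split=> // _; rewrite theta_root kidflow_root.
have [_ dx] := parP htree xr.
have xk : x \in kids (par x) by rewrite mem_kids // xr eqxx.
have le1 : theta N x <= subflow N x.
  rewrite (theta_kid _ xk).
  have [h _] := IH (par x) ltac:(lia) ltac:(lia).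
  have {}h := h ltac:(lia).
  have [->|k0] := eqVneq (kidflow N (par x)) 0.
    by rewrite invr0 !mulr0 subflow_ge0.
  have kp : 0 < kidflow N (par x) by rewrite lt0r k0 kidflow_ge0.
  rewrite mulrCA ler_piMr ?subflow_ge0 //.
  by rewrite ler_pdivrMr // mul1r.
by split=> // h; apply: le_trans le1 _; exact: subflow_kidflow.
Qed.

Lemma theta_sum N x : (depth x <= N)%N -> \sum_(y <- kids x) theta N y = theta N x.
Proof.
move=> xN; have -> : \sum_(y <- kids x) theta N y = theta N x * (kidflow N x / kidflow N x).
  rewrite {2}/kidflow mulr_suml mulr_sumr big_seq [RHS]big_seq.
  by apply: eq_bigr => y; exact: theta_kid.
have [k0|k0] := eqVneq (kidflow N x) 0; last by rewrite divff // mulr1.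
have [/(_ xN)] := theta_le (leqW xN); rewrite k0 => h _.
have -> : theta N x = 0 by apply/eqP; rewrite eq_le h theta_ge0.
by rewrite mul0r.
Qed.

End MaxFlow.

(** Max-flow min-cut with capacities [exp(-|e|^lam)]. *)
Lemma flow_exists (lam c0 : R) : 0 < c0 ->
  (c0%:E <= ereal_inf [set cutset_sum adj root lam pi | pi in cutset adj root])%E ->
  forall N, exists th : V -> R,
    [/\ forall x, 0 <= th x, th root = 1,
        forall x, (depth x <= N)%N -> \sum_(y <- kids x) th y = th x &
        forall x, x != root -> (depth x <= N.+1)%N ->
          th x <= expR (- ((depth x)%:R `^ lam)) / c0].
Proof.
move=> c00 hc0 N; pose cap k : R := expR (- (k%:R `^ lam)).
have cap0 k : 0 <= cap k by exact: expR_ge0.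
have big : c0 <= rootflow cap N.
  rewrite -lee_fin; apply: le_trans hc0 _.
  apply: (@le_trans _ _ (cutset_sum adj root lam [set e | exists2 x, x \in rootcut cap N & e = edge x])).
    by apply: ereal_inf_lbound; eexists; [exact: rootcut_cutset|].
  set E := [set e | _].
  have eE : E = [set` undup (map edge (rootcut cap N))].
    apply/seteqP; split=> e /=.
      by move=> [x xc ->]; rewrite mem_undup; exact/map_f.
    by rewrite mem_undup => /mapP[x xc ->]; exists x.
  rewrite /cutset_sum eE esum_fset; [|exact: finite_seq|by move=> e _; rewrite lee_fin expR_ge0].
  rewrite -fsbig_seq ?undup_uniq // sumEFin lee_fin.
  have -> : rootflow cap N = \sum_(e <- map edge (rootcut cap N)) cap (edge_depth adj root e).
    rewrite big_map big_seq; under eq_bigr => x xc.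
      rewrite edge_depth_edge //; first over.
      exact: rootcut_neq xc.
    rewrite -big_seq /rootcut big_flatten big_map; apply: eq_bigr => y _.
    by rewrite sum_mincut.
  apply: ler_sum_subseq; first exact: undup_uniq.
    by move=> e; rewrite mem_undup.
  by move=> e _; exact: cap0.
have rf0 : 0 < rootflow cap N by exact: lt_le_trans big.
exists (fun x => theta cap N x / rootflow cap N); split.
- by move=> x; rewrite divr_ge0 ?(ltW rf0) // theta_ge0.
- by rewrite theta_root divff // gt_eqF.
- by move=> x xN; rewrite -mulr_suml theta_sum.
- move=> x xr xN; apply: ler_pM; rewrite ?theta_ge0 ?invr_ge0 ?(ltW rf0) //.
    have [_ /(_ xr) h] := theta_le cap0 xN.
    by apply: le_trans h _; exact: maxflow_cap.
  by rewrite lef_pV2 ?posrE.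
Qed.

End Cutsets.

(** * Slowly varying tails *)

Section Growth.
Variable R : realType.

Lemma powR_add (x r s : R) : 0 < x -> x `^ (r + s) = x `^ r * x `^ s.
Proof. by move=> x0; rewrite powRD // (gt_eqF x0) implybT. Qed.

Lemma powR_le1 (t e : R) : 1 <= t -> e <= 0 -> t `^ e <= 1.
Proof. by move=> t1 e0; rewrite -[leRHS](powRr0 t); exact: ler_powR. Qed.

Lemma powR_le_anti (a b e : R) : 0 < a -> a <= b -> e <= 0 -> b `^ e <= a `^ e.
Proof.
move=> a0 ab e0; have b0 := lt_le_trans a0 ab.
rewrite -(opprK e) !(powRN _ (- e)) lef_pV2 ?posrE ?powR_gt0 //.
by apply: ge0_ler_powR; rewrite ?nnegrE ?oppr_ge0 // ltW.
Qed.

Lemma powR_dominates (B s s' : R) : s < s' ->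
  exists n0 : nat, forall n : nat, (n0 <= n)%N -> B * n%:R `^ s <= n%:R `^ s'.
Proof.
move=> ss'; pose B' := Num.max B 1.
have B1 : 1 <= B' by rewrite le_max lexx orbT.
have BB : B <= B' by rewrite le_max lexx.
pose x := B' `^ (s' - s)^-1.
exists (Num.truncn x).+1 => n xn.
have xn' : x < n%:R.
  apply: lt_le_trans (truncnS_gt x) _; by rewrite ler_nat.
have x0 : 0 < x by rewrite powR_gt0 //; lra.
have n0 : 0 < n%:R :> R by exact: lt_trans xn'.
have -> : s' = (s' - s) + s by ring.
rewrite powR_add // ler_wpM2r ?powR_ge0 //.
apply: le_trans BB _.
have -> : B' = x `^ (s' - s).
  by rewrite /x -powRrM mulVf ?powRr1 ?subr_eq0 ?gt_eqF //; lra.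
by apply: ge0_ler_powR; rewrite ?nnegrE ?ltW // ?subr_gt0.
Qed.

Lemma le_expR_powR (s : R) (n : nat) : 0 < s -> n%:R <= expR (s^-1 * n%:R `^ s).
Proof.
move=> s0; case: n => [|n]; first by rewrite expR_ge0.
have n0 : 0 < n.+1%:R :> R by rewrite ltr0n.
rewrite -{1}(@lnK _ (n.+1%:R : R)) ?posrE // ler_expR.
rewrite mulrC ler_pdivlMr // mulrC -ln_powR.
have p0 : 0 < n.+1%:R `^ s :> R by rewrite powR_gt0.
have h : ln (1 + (n.+1%:R `^ s - 1)) <= n.+1%:R `^ s - 1 :> R by apply: le_ln1Dx; lra.
by move: h; rewrite addrCA subrr addr0 => h; lra.
Qed.

(** A telescoping substitute for the comparison of [sum j^(s-1)] with an
    integral. *)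
Lemma powR_step (s : R) (j : nat) : 0 < s <= 1 -> (0 < j)%N ->
  (s / 2) * j.+1%:R `^ (s - 1) <= j.+1%:R `^ s - j%:R `^ s.
Proof.
move=> /andP[s0 s1] j0; set x : R := j.+1%:R.
have x1 : 1 < x by rewrite /x ltr1n.
have x0 : 0 < x by lra.
have jx : j%:R = x * (1 - x^-1).
  by rewrite mulrBr mulr1 divff ?gt_eqF // /x -natr1 addrK.
clearbody x.
have ix0 : 0 < x^-1 by rewrite invr_gt0.
have ix1 : x^-1 < 1 by rewrite invf_lt1.
have bd : (1 - x^-1) `^ s <= (1 + s / x)^-1.
  have xx : 0 < 1 - x^-1 by lra.
  rewrite /powR (gt_eqF xx).
  have h1 : s * ln (1 - x^-1) <= - (s / x).
    rewrite -mulrN ler_wpM2l ?(ltW s0) //; apply: le_ln1Dx; lra.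
  apply: (@le_trans _ _ (expR (- (s / x)))); first by rewrite ler_expR.
  rewrite expRN lef_pV2 ?posrE ?expR_gt0 ?expR_ge1Dx //.
  have : 0 < s / x by rewrite divr_gt0. 
  lra.
rewrite jx powRM ?(ltW x0) //; last lra.
have -> : x `^ (s - 1) = x `^ s / x.
  by rewrite powR_add // powR_inv1 // ltW.
have p0 : 0 <= x `^ s by exact: powR_ge0.
have -> : s / 2 * (x `^ s / x) = x `^ s * (s / x / 2) by field; rewrite gt_eqF.
rewrite -[X in X - _]mulr1 -mulrBr ler_wpM2l //.
have u0 : 0 < s / x by rewrite divr_gt0.
have u1 : s / x <= 1 by rewrite ler_pdivrMr //; lra.
apply: (@le_trans _ _ (1 - (1 + s / x)^-1)); last by lra.
rewrite lerBrDr -lerBrDl; rewrite -[(1 + _)^-1]mul1r ler_pdivrMr; last lra.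
by nra.
Qed.

Lemma sum_powR (s : R) (m k : nat) : 0 < s <= 1 -> (0 < m)%N ->
  \sum_(m <= j < k) j.+1%:R `^ (s - 1) <= 2 / s * k%:R `^ s.
Proof.
move=> s01 m0; have /andP[s0 s1] := s01.
have [mk|km] := leqP m k; last first.
  by rewrite big_geq ?(ltnW km) // mulr_ge0 ?powR_ge0 // divr_ge0 // ltW.
have : (s / 2) * \sum_(m <= j < k) j.+1%:R `^ (s - 1) <= k%:R `^ s - m%:R `^ s.
  rewrite -(telescope_sumr (fun j => j%:R `^ s) mk) mulr_sumr.
  rewrite big_nat_cond [leRHS]big_nat_cond; apply: ler_sum => j /andP[/andP[mj _] _].
  by apply: powR_step => //; lia.
have := powR_ge0 (m%:R : R) s => p0 h.
have e : s / 2 * (2 / s) = 1 by field; rewrite gt_eqF.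
rewrite -(ler_pM2l (_ : 0 < s / 2)); last by rewrite divr_gt0.
rewrite mulrA e mul1r; lra.
Qed.

(** Potter-type bounds for [q]: since [q] is monotone and bounded, it is enough
    to compare its values at [t] and [2 * t]. *)
Section Tail.
Variables (lam : R) (L : R -> R).
Hypothesis hlam : 0 < lam < 1.
Hypothesis hL : slowly_varying L.
Let q t := L t * t `^ (lam - 1).
Hypothesis q01 : forall t, 1 <= t -> 0 <= q t <= 1.
Hypothesis q_mono : forall s t, 1 <= s -> s <= t -> q t <= q s.

Lemma slow_double (eps : R) : 0 < eps -> exists t0 : R, 1 <= t0 /\
  forall t, t0 <= t -> 0 < L t /\ 2 `^ (- eps) * L t <= L (2 * t) <= 2 `^ eps * L t.
Proof.
move=> e0; case: hL => L0 /(_ 2 ltac:(lra)) cv.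
have lo : 2 `^ (- eps) < 1 :> R.
  rewrite -[ltRHS](powRr0 2) /powR gt_eqF // ltr_expR mul0r mulNr oppr_lt0.
  by rewrite mulr_gt0 // ln_gt0 // ltr1n.
have hi : 1 < 2 `^ eps :> R.
  rewrite -[ltLHS](powRr0 2) /powR gt_eqF // ltr_expR mul0r.
  by rewrite mulr_gt0 // ln_gt0 // ltr1n.
have lop : 0 < 2 `^ (- eps) :> R by rewrite powR_gt0.
pose d := Num.min (1 - 2 `^ (- eps)) (2 `^ eps - 1).
have d0 : 0 < d by rewrite lt_min !subr_gt0 lo hi.
move/cvgrPdist_lt: cv => /(_ d d0) [M [_ HM]].
exists (Num.max 1 (M + 1)); split; first by rewrite le_max lexx.
move=> t; rewrite ge_max => /andP[t1 tM].
have := HM t ltac:(lra); rewrite /= ltr_distlC => /andP[h1 h2].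
have d1 : d <= 1 - 2 `^ (- eps) by rewrite ge_min lexx.
have d2 : d <= 2 `^ eps - 1 by rewrite ge_min lexx orbT.
have Lt : 0 < L t.
  rewrite lt0r L0 // andbT; apply/eqP => e.
  by move: h1; rewrite e invr0 mulr0; lra.
split=> //; apply/andP; split.
  by rewrite -ler_pdivlMr //; lra.
by rewrite -ler_pdivrMr //; lra.
Qed.

Lemma doubling_ind (A : R -> Prop) (t0 : R) : 0 < t0 ->
  (forall t, t0 <= t <= 2 * t0 -> A t) ->
  (forall t, t0 <= t -> A t -> A (2 * t)) -> forall t, t0 <= t -> A t.
Proof.
move=> t00 base step.
have main (k : nat) : forall t, t0 <= t <= 2 ^+ k * t0 -> A t.
  elim: k => [|k IH] t /andP[h1 h2].
    by apply: base; move: h2; rewrite expr0 => h2; lra.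
  have [h|h] := leP t (2 * t0); first by apply: base; rewrite h1.
  have -> : t = 2 * (t / 2) by field.
  apply: step; first lra.
  by apply: IH; move: h2; rewrite exprS => h2; lra.
move=> t tt; apply: (main (Num.truncn (t / t0)).+1); rewrite tt /=.
rewrite -ler_pdivrMr //; apply: ltW; apply: lt_le_trans (truncnS_gt _) _.
by rewrite -natrX ler_nat ltnW // ltn_expl.
Qed.

Lemma tail_lower (eps : R) : 0 < eps -> exists a t0 : R, [/\ 0 < a, 1 <= t0 &
  forall t, t0 <= t -> a * t `^ (lam - 1 - eps) <= q t].
Proof.
move=> e0; have [t0 [t1 H]] := slow_double e0; have /andP[l0 l1] := hlam.
have t00 : 0 < t0 by lra.
exists (q (2 * t0)), t0; split=> //.
  have [h _] := H (2 * t0) ltac:(lra).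
  by rewrite mulr_gt0 // powR_gt0 //; lra.
have q0 : 0 <= q (2 * t0) by have /andP[] := q01 (t := 2 * t0) ltac:(lra).
apply: doubling_ind => // [t /andP[h1 h2]|t h IH].
  apply: (@le_trans _ _ (q (2 * t0))); last by apply: q_mono; lra.
  by rewrite ler_piMr // powR_le1; lra.
have [Lt /andP[lo hi]] := H t h.
have tp : 0 <= t by lra.
rewrite (powRM _ _ tp) //; apply: (@le_trans _ _ (2 `^ (lam - 1 - eps) * q t)).
  by rewrite mulrCA ler_wpM2l ?powR_ge0.
rewrite [leRHS]/q powRM //.
have -> : 2 `^ (lam - 1 - eps) = 2 `^ (lam - 1) * 2 `^ (- eps) :> R.
  by rewrite -powRD // pnatr_eq0 implybT.
rewrite /q; have -> : 2 `^ (lam - 1) * 2 `^ (- eps) * (L t * t `^ (lam - 1)) =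
  2 `^ (- eps) * L t * (2 `^ (lam - 1) * t `^ (lam - 1)) by ring.
by rewrite ler_wpM2r // mulr_ge0 // powR_ge0.
Qed.

Lemma tail_upper (eps : R) : 0 < eps -> lam + eps <= 1 -> exists b t0 : R, [/\ 0 < b, 1 <= t0 &
  forall t, t0 <= t -> q t <= b * t `^ (lam - 1 + eps)].
Proof.
move=> e0 le1; have [t0 [t1 H]] := slow_double e0; have /andP[l0 l1] := hlam.
have t00 : 0 < t0 by lra.
have p0 : 0 < (2 * t0) `^ (lam - 1 + eps) by rewrite powR_gt0 //; lra.
exists (((2 * t0) `^ (lam - 1 + eps))^-1), t0; split=> //; first by rewrite invr_gt0.
apply: doubling_ind => // [t /andP[h1 h2]|t h IH].
  apply: (@le_trans _ _ 1); first by have /andP[] := q01 (t := t) ltac:(lra).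
  rewrite mulrC ler_pdivlMr // mul1r; apply: powR_le_anti; lra.
have [Lt /andP[lo hi]] := H t h.
have tp : 0 <= t by lra.
rewrite /q; apply: (@le_trans _ _ (2 `^ (lam - 1 + eps) * q t)); last first.
  by rewrite (@powRM _ 2 t) // [leRHS]mulrCA ler_wpM2l ?powR_ge0.
have -> : 2 `^ (lam - 1 + eps) = 2 `^ (lam - 1) * 2 `^ eps :> R.
  by rewrite -powRD // pnatr_eq0 implybT.
rewrite powRM // /q; have -> : 2 `^ (lam - 1) * 2 `^ eps * (L t * t `^ (lam - 1)) =
  2 `^ eps * L t * (2 `^ (lam - 1) * t `^ (lam - 1)) by ring.
by rewrite ler_wpM2r // mulr_ge0 // powR_ge0.
Qed.

(** [(1 - q n)^n <= exp(-n q(n))], and [n q(n)] is eventually larger than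
    [n^lam']. *)
Lemma miss_bound (lam' : R) : lam' < lam -> exists n0 : nat, (0 < n0)%N /\
  forall n : nat, (n0 <= n)%N -> (1 - q n%:R) ^+ n <= expR (- (n%:R `^ lam')).
Proof.
move=> ll; pose eps := (lam - lam') / 2.
have e0 : 0 < eps by rewrite divr_gt0 // subr_gt0.
have [a [t0 [a0 t1 H]]] := tail_lower e0.
have [n1 Hn1] := @powR_dominates a^-1 lam' (lam - eps) ltac:(rewrite /eps; lra).
exists (maxn n1 (Num.truncn t0).+1); split; first by rewrite leq_max orbT.
move=> n; rewrite geq_max => /andP[nn1 nt].
have tn : t0 <= n%:R.
  by apply: ltW; apply: lt_le_trans (truncnS_gt t0) _; rewrite ler_nat.
have n0 : 0 < n%:R :> R by lra.
have /andP[q0 q1] := q01 (t := n%:R) ltac:(lra).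
apply: (@le_trans _ _ (expR (- q n%:R) ^+ n)).
  by apply: lerXn2r; rewrite ?nnegrE ?expR_ge0 ?subr_ge0 // expR_ge1Dx.
rewrite -expRM_natl ler_expR mulrN lerN2.
have := Hn1 n nn1; rewrite ler_pdivrMl // => h; apply: le_trans h _.
have -> : n%:R `^ (lam - eps) = n%:R * n%:R `^ (lam - 1 - eps) :> R.
  have -> : lam - eps = 1 + (lam - 1 - eps) by ring.
  by rewrite (powR_add 1) // powRr1 // ltW.
by rewrite mulrCA ler_wpM2l ?(ltW n0) // H.
Qed.

(** [1 - q >= exp(-2q)] for [q <= 1/2], and the sum of [q j] over [j <= k] is
    of order at most [k^s]. *)
Lemma product_lower (s : R) : lam < s < 1 -> exists (m0 : nat) (B : R), [/\ (0 < m0)%N, 0 <= B,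
  forall j : nat, (m0 <= j)%N -> q j%:R <= 2^-1 &
  forall m k : nat, (m0 <= m)%N ->
    expR (- (B * k%:R `^ s)) <= \prod_(m <= j < k) (1 - q j.+1%:R)].
Proof.
move=> /andP[ls s1]; have /andP[l0 l1] := hlam; pose eps := s - lam.
have [b [t0 [b0 t1 H]]] := @tail_upper eps ltac:(rewrite /eps; lra) ltac:(rewrite /eps; lra).
have es : lam - 1 + eps = s - 1 by rewrite /eps; ring.
rewrite es in H.
have [n1 Hn1] := @powR_dominates (2 * b) (s - 1) 0 ltac:(lra).
pose m0 := maxn n1 (Num.truncn t0).+1.
have Hm j : (m0 <= j)%N -> (n1 <= j)%N /\ t0 <= j%:R.
  rewrite geq_max => /andP[h1 h2]; split=> //.
  by apply: ltW; apply: lt_le_trans (truncnS_gt t0) _; rewrite ler_nat.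
have qh j : (m0 <= j)%N -> q j%:R <= 2^-1.
  move=> /Hm[h1 h2]; apply: le_trans (H _ h2) _.
  have := Hn1 j h1; rewrite powRr0; lra.
exists m0, (4 * b / s); split=> //.
- by rewrite leq_max orbT.
- by rewrite divr_ge0 ?mulr_ge0 ?(ltW b0) //; lra.
move=> m k mm.
have m1 : (0 < m)%N by apply: leq_trans mm; rewrite leq_max orbT.
apply: (@le_trans _ _ (\prod_(m <= j < k) expR (- (2 * q j.+1%:R)))); last first.
  rewrite big_nat_cond [leRHS]big_nat_cond; apply: ler_prod => j /andP[/andP[mj _] _].
  rewrite expR_ge0 /= expRN.
  have qj := qh j.+1 ltac:(lia).
  have /andP[q0 _] := q01 (t := j.+1%:R) ltac:(by rewrite ler1n).
  apply: (@le_trans _ _ ((1 + 2 * q j.+1%:R)^-1)).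
    by rewrite lef_pV2 ?posrE ?expR_gt0 ?expR_ge1Dx //; lra.
  by rewrite -[X in X <= _]mul1r ler_pdivrMr; nra.
rewrite -expR_sum ler_expR sumrN lerN2 -mulr_sumr.
apply: (@le_trans _ _ (2 * (b * (2 / s * k%:R `^ s)))); last first.
  rewrite le_eqVlt; apply/orP; left; apply/eqP; ring.
rewrite ler_pM2l //.
apply: (@le_trans _ _ (b * \sum_(m <= j < k) j.+1%:R `^ (s - 1))); last first.
  by rewrite ler_pM2l // sum_powR //; lra.
rewrite mulr_sumr big_nat_cond [leRHS]big_nat_cond; apply: ler_sum => j /andP[/andP[mj _] _].
by apply: H; have [] := Hm j.+1 ltac:(lia).
Qed.

(** The second moment of the random flow is controlled by a series whose general
    term decays like [exp(-k^lam')] up to smaller stretched exponentials;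
    comparing it with a telescoping series gives an explicit tail. *)
Lemma series_bound (lam' c0 : R) : lam < lam' -> 0 < c0 -> exists m0 : nat, [/\ (0 < m0)%N,
  forall j : nat, (m0 <= j)%N -> q j%:R <= 2^-1 &
  forall m k : nat, (m0 <= m)%N -> (m < k)%N ->
    (1 + \sum_(m <= j < k) expR (j.+1%:R `^ lam)) / (\prod_(m <= j < k) (1 - q j.+1%:R))
      * (expR (- (k%:R `^ lam')) / c0) <= k.-1%:R^-1 - k%:R^-1].
Proof.
move=> ll c00; have /andP[l0 l1] := hlam.
pose s' := Num.min lam' 1; pose s := (lam + s') / 2.
have s'1 : s' <= 1 by rewrite ge_min lexx orbT.
have s'l : s' <= lam' by rewrite ge_min lexx.
have s'g : lam < s' by rewrite lt_min ll l1.
have s0 : 0 < s by rewrite /s; lra.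
have [m0 [B [m00 B0 qh HB]]] := @product_lower s ltac:(rewrite /s; lra).
(* the exponents of [k^3], [exp(k^lam)], the inverse product and [2 / c0], each
   measured in units of [k^s] *)
pose E := 3 * s^-1 + 1 + B + `|ln (2 / c0)|.
have [n1 Hn1] := @powR_dominates E s lam' ltac:(rewrite /s; lra).
exists (maxn m0 n1); split; first by rewrite leq_max m00.
  by move=> j; rewrite geq_max => /andP[h _]; exact: qh.
move=> m k; rewrite geq_max => /andP[mm0 mn1] mk.
have k1 : 1 < k%:R :> R by rewrite ltr1n; lia.
have k0 : 0 < k%:R :> R by lra.
have ks1 : 1 <= k%:R `^ s :> R by rewrite -[leLHS](powRr0 (k%:R : R)) ler_powR //; lra.
set y := k%:R `^ s in ks1.
have prod_ge := HB m k mm0; rewrite -/y in prod_ge.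
have kl : k%:R `^ lam <= y by apply: ler_powR; rewrite /s; lra.
have sum_le : 1 + \sum_(m <= j < k) expR (j.+1%:R `^ lam) <= k%:R * expR y.
  have : \sum_(m <= j < k) expR (j.+1%:R `^ lam) <= \sum_(m <= j < k) expR y.
    rewrite big_nat_cond [leRHS]big_nat_cond; apply: ler_sum => j /andP[/andP[_ jk] _].
    rewrite ler_expR; apply: le_trans kl; apply: ge0_ler_powR; rewrite ?nnegrE ?ler0n ?ler_nat //.
    exact: ltW.
  rewrite sumr_const_nat -[_ *+ (k - m)]mulr_natr => h.
  have : (k - m)%:R <= k%:R - 1 :> R.
    by rewrite lerBrDr natr1 ler_nat ltn_subrL (leq_trans m00 mm0) (leq_ltn_trans _ mk).
  have e1 : 1 <= expR y by rewrite -[leLHS]expR0 ler_expR; lra.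
  by nra.
have kE : k%:R <= expR (s^-1 * y) by exact: le_expR_powR.
have Ey : E * y <= k%:R `^ lam' by apply: Hn1; exact: leq_trans mn1 (ltnW mk).
have c2 : 2 / c0 <= expR (`|ln (2 / c0)| * y).
  have p : 0 < 2 / c0 by rewrite divr_gt0.
  rewrite -{1}(@lnK _ (2 / c0)) ?posrE // ler_expR.
  apply: le_trans (ler_norm _) _; rewrite ler_peMr //.
have pr0 : 0 < \prod_(m <= j < k) (1 - q j.+1%:R).
  by apply: lt_le_trans prod_ge; exact: expR_gt0.
have rhs : (k%:R * k%:R)^-1 <= k.-1%:R^-1 - k%:R^-1 :> R.
  have kp : k%:R = k.-1%:R + 1 :> R by rewrite natr1 prednK // (leq_ltn_trans _ mk).
  have kp0 : 0 < k.-1%:R :> R by lra.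
  have -> : k.-1%:R^-1 - k%:R^-1 = (k%:R * k.-1%:R)^-1 :> R.
    by rewrite kp; field; rewrite !gt_eqF //; lra.
  by rewrite lef_pV2 ?posrE ?mulr_gt0 // ler_pM2l //; lra.
apply: le_trans rhs.
apply: (@le_trans _ _ (k%:R * expR y * expR (B * y) * (expR (- (k%:R `^ lam')) / c0))).
  rewrite ler_wpM2r ?divr_ge0 ?expR_ge0 ?(ltW c00) //.
  apply: ler_pM => //.
  - by rewrite addr_ge0 // sumr_ge0 // => j _; exact: expR_ge0.
  - by rewrite invr_ge0 ltW.
  - by rewrite -[leRHS]invrK -expRN lef_pV2 ?posrE ?expR_gt0.
rewrite -[leRHS]mul1r ler_pdivlMr ?mulr_gt0 //.
have -> : k%:R * expR y * expR (B * y) * (expR (- k%:R `^ lam') / c0) * (k%:R * k%:R) =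
   k%:R * k%:R * k%:R * (expR y * expR (B * y)) * c0^-1 * expR (- k%:R `^ lam') by ring.
apply: (@le_trans _ _ (expR (E * y) * expR (- k%:R `^ lam'))); last first.
  by rewrite -expRD -[leRHS]expR0 ler_expR; lra.
rewrite ler_wpM2r ?expR_ge0 //.
have -> : E * y = s^-1 * y + s^-1 * y + s^-1 * y + (y + B * y) + `|ln (2 / c0)| * y.
  by rewrite /E; ring.
rewrite !expRD; apply: ler_pM => //.
- by rewrite invr_ge0 ltW.
- rewrite ler_wpM2r ?mulr_ge0 ?expR_ge0 //.
  by rewrite !ler_pM ?mulr_ge0 ?expR_ge0 ?ler0n.
- apply: le_trans c2; rewrite ler_peMl ?invr_ge0 ?(ltW c00) //; lra.
Qed.

End Tail.
End Growth.

(** * Null sets and simple functions *)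

Section Expect.
Variables (R : realType) (d : measure_display) (T : measurableType d) (P : probability T R).

Lemma small_null (G : T -> Prop) :
  (forall e : R, 0 < e -> exists B, [/\ measurable B, (P B <= e%:E)%E & forall w, ~ B w -> G w]) ->
  {ae P, forall w, G w}.
Proof.
move=> H; have H' k : exists B, [/\ measurable B, (P B <= (k.+1%:R^-1)%:E)%E & forall w, ~ B w -> G w].
  by apply: H; rewrite invr_gt0.
have [B HB] := choice H'; exists (\bigcap_k B k); split.
- by apply: bigcapT_measurable => k; have [] := HB k.
- apply/eqP; rewrite eq_le measure_ge0 andbT; apply/lee_addgt0Pr => e e0.
  rewrite add0e.
  have ke : (Num.truncn e^-1).+1%:R^-1 <= e.
    rewrite -[leRHS]invrK lef_pV2 ?posrE ?invr_gt0 //.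
    exact/ltW/truncnS_gt.
  have [mB PB _] := HB (Num.truncn e^-1).
  apply: le_trans (le_trans PB _); last by rewrite lee_fin.
  apply: le_measure; rewrite ?inE //; last by apply: bigcap_inf.
  by apply: bigcapT_measurable => k; have [] := HB k.
- move=> w /= nG k _; apply: contrapT => nB; apply: nG.
  by have [_ _] := HB k; apply.
Qed.

Lemma le_measure_bigU (I : eqType) (s : seq I) (A : I -> set T) (e : I -> R) :
  (forall i, i \in s -> measurable (A i) /\ (P (A i) <= (e i)%:E)%E) ->
  measurable [set w | exists2 i, i \in s & A i w] /\
  (P [set w | exists2 i, i \in s & A i w] <= (\sum_(i <- s) e i)%:E)%E.
Proof.
elim: s => [|a s IH] H.
  have -> : [set w | exists2 i, i \in [::] & A i w] = set0.
    by apply/seteqP; split=> w // [].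
  by rewrite measure0 big_nil.
have [ms Ps] := IH ltac:(by move=> i i_s; apply: H; rewrite inE i_s orbT).
have [ma Pa] := H a ltac:(by rewrite mem_head).
have -> : [set w | exists2 i, i \in a :: s & A i w] = A a `|` [set w | exists2 i, i \in s & A i w].
  apply/seteqP; split=> w /=.
    by move=> [i]; rewrite inE => /orP[/eqP ->|]; [left|right; exists i].
  by move=> [h|[i i_s h]]; [exists a; rewrite ?mem_head|exists i; rewrite // inE i_s orbT].
split; first exact: measurableU.
rewrite big_cons EFinD; apply: (le_trans (measureU2 P ma ms)); exact: leeD.
Qed.

Lemma integral_comb (I : Type) (s : seq I) (k : I -> R) (A : I -> set T) :
  (forall i, 0 <= k i) -> (forall i, measurable (A i)) ->
  (\int[P]_w (\sum_(i <- s) k i * \1_(A i) w)%:E = (\sum_(i <- s) k i * fine (P (A i)))%:E)%E.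
Proof.
move=> k0 mA; under eq_integral do rewrite -sumEFin.
rewrite ge0_integral_sum //; last first.
- by move=> i w _; rewrite lee_fin mulr_ge0.
- move=> i; apply/measurable_EFinP; apply: measurable_funM => //.
rewrite -sumEFin; apply: eq_bigr => i _.
under eq_integral do rewrite EFinM.
rewrite ge0_integralZl_EFin //; last exact/measurable_EFinP.
by rewrite integral_indic // setIT EFinM fineK // fin_num_measure.
Qed.

(** Monotonicity of the expectation for nonnegative simple functions, one
    indicator with coefficient [a0] and one constant [b0] being split off.
    Applied to an indicator it contains Markov's inequality. *)
Lemma expect_le (I J : Type) (s : seq I) (k : I -> R) (A : I -> set T) (a0 : R) (A0 : set T)
    (t : seq J) (k' : J -> R) (B : J -> set T) (b0 : R) :
  0 <= a0 -> 0 <= b0 -> measurable A0 ->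
  (forall i, 0 <= k i) -> (forall i, measurable (A i)) ->
  (forall i, 0 <= k' i) -> (forall i, measurable (B i)) ->
  (forall w, a0 * \1_A0 w + \sum_(i <- s) k i * \1_(A i) w
     <= b0 + \sum_(j <- t) k' j * \1_(B j) w) ->
  a0 * fine (P A0) + \sum_(i <- s) k i * fine (P (A i))
     <= b0 + \sum_(j <- t) k' j * fine (P (B j)).
Proof.
move=> a00 b00 mA0 k0 mA k'0 mB H.
pose K (i : option I) := if i is Some i then k i else a0.
pose AA (i : option I) := if i is Some i then A i else A0.
pose K' (i : option J) := if i is Some i then k' i else b0.
pose BB (i : option J) := if i is Some i then B i else setT.
have K0 i : 0 <= K i by case: i => /=.
have K'0 i : 0 <= K' i by case: i => /=.
have mAA i : measurable (AA i) by case: i => /=.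
have mBB i : measurable (BB i) by case: i => /=.
have := integral_comb (None :: map Some s) K0 mAA.
have := integral_comb (None :: map Some t) K'0 mBB.
rewrite !big_cons !big_map /= probability_setT /= mulr1 => e1 e2.
rewrite -lee_fin -e1 -e2; apply: ge0_le_integral => //.
- by move=> w _; rewrite lee_fin sumr_ge0 // => i _; rewrite mulr_ge0.
- by apply/measurable_EFinP; apply: measurable_sum => i; apply: measurable_funM.
- by apply/measurable_EFinP; apply: measurable_sum => i; apply: measurable_funM.
- move=> w _; rewrite lee_fin !big_cons !big_map /= indicT mulr1; exact: H.
Qed.

End Expect.

(** * Random conductances *)

Section Network.
Variables (V : choiceType) (adj : rel V) (root : V).
Hypothesis htree : is_tree adj.
Hypothesis hlf : locally_finite adj.
Hypothesis hinf : infinite_set [set: V].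
Variables (R : realType) (lam : R).
Hypothesis hlam : 0 < lam < 1.
Variables (d : measure_display) (T : measurableType d) (P : probability T R).
Variable C : {fset V} -> {RV P >-> R}.
Hypothesis hpos : forall e w, edges adj e -> 0 < C e w.
Hypothesis hindep : independent_on (edges adj) C.
Variable L : R -> R.
Hypothesis hL : slowly_varying L.
Hypothesis htail : forall (t : R) (e : {fset V}), 1 <= t -> edges adj e ->
     P [set w | C e w < expR (- (t `^ lam))] = (L t * t `^ (lam - 1))%:E.

Local Notation depth := (depth adj root).
Local Notation par := (par adj root).
Local Notation kids := (kids adj root).
Local Notation lev := (lev adj root).
Local Notation anc := (anc adj root).
Local Notation below := (below adj root).
Local Notation edge := (edge adj root).
Local Notation hit := (hit adj root).
Local Notation Cw w := (fun e => C e w).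

Definition tail t : R := L t * t `^ (lam - 1).

Lemma measurable_lt e a : measurable [set w | C e w < a].
Proof.
have -> : [set w | C e w < a] = C e @^-1` `]-oo, a[%classic.
  by apply/seteqP; split=> w; rewrite /= in_itv.
by rewrite -[X in measurable X]setTI; exact: measurable_funP.
Qed.

Definition atleast (a : R) (e : {fset V}) : set T := [set w | a <= C e w].

Lemma atleastE a e : atleast a e = C e @^-1` `[a, +oo[%classic.
Proof. by apply/seteqP; split=> w; rewrite /atleast /= in_itv /= andbT. Qed.

Lemma atleastC a e : atleast a e = ~` [set w | C e w < a].
Proof. by apply/seteqP; split=> w; rewrite /atleast /=; rewrite leNgt => /negP. Qed.

Lemma measurable_atleast a e : measurable (atleast a e).
Proof. by rewrite atleastC; exact/measurableC/measurable_lt. Qed.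

Lemma P_atleast t e : 1 <= t -> edges adj e ->
  P (atleast (expR (- (t `^ lam))) e) = (1 - tail t)%:E.
Proof.
move=> t1 he; rewrite atleastC probability_setC; last exact: measurable_lt.
by rewrite htail // -EFinB.
Qed.

Lemma exists_edge : exists e, edges adj e.
Proof.
have := nb_neq0 htree hlf hinf root; case E : (nb adj root) => [//|y s] _.
exists [fset root; y]%fset; exists root, y; split=> //.
by rewrite -mem_nb // E mem_head.
Qed.

Lemma tail01 t : 1 <= t -> 0 <= tail t <= 1.
Proof.
move=> t1; have [e he] := exists_edge; rewrite /tail -!lee_fin -(htail t1 he).
by rewrite measure_ge0 probability_le1 //; exact: measurable_lt.
Qed.

Lemma tail_mono s t : 1 <= s -> s <= t -> tail t <= tail s.
Proof.
move=> s1 st; have t1 : 1 <= t by lra.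
have [e he] := exists_edge; rewrite /tail -lee_fin -(htail t1 he) -(htail s1 he).
apply: le_measure; rewrite ?inE; [exact: measurable_lt|exact: measurable_lt|].
move=> w /= h; apply: lt_le_trans h _; rewrite ler_expR lerN2.
by have /andP[l0 _] := hlam; apply: ge0_ler_powR; rewrite ?nnegrE //; lra.
Qed.

Definition allatleast (tau : nat -> R) (s : seq V) : set T :=
  [set w | forall x, x \in s -> tau (depth x) <= C (edge x) w].

Lemma measurable_allatleast tau s : measurable (allatleast tau s).
Proof.
elim: s => [|a s IH].
  by have -> : allatleast tau [::] = setT by apply/seteqP.
have -> : allatleast tau (a :: s) = atleast (tau (depth a)) (edge a) `&` allatleast tau s.
  apply/seteqP; split=> w /=.
    by move=> h; split=> [|x xs]; apply: h; rewrite inE ?eqxx // xs orbT.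
  by move=> [h1 h2] x; rewrite inE => /orP[/eqP ->|/h2].
by apply: measurableI => //; exact: measurable_atleast.
Qed.

(** Independence along a finite set of edges, with thresholds that depend on
    the depth. *)
Lemma P_allatleast tau s : uniq s -> (forall x, x \in s -> x != root) ->
  P (allatleast tau s) = (\prod_(x <- s) P (atleast (tau (depth x)) (edge x)))%E.
Proof.
move=> us hs; pose J := [fset e in map edge s]%fset.
pose B (e : {fset V}) : set R := `[tau (edge_depth adj root e), +oo[%classic.
have uE : uniq (map edge s).
  by rewrite map_inj_in_uniq // => x y xs ys; apply: edge_inj; rewrite ?hs.
have := hindep (J := J) (B := B).
have -> : \bigcap_(i in [set` J]) (C i @^-1` B i) = allatleast tau s.
  apply/seteqP; split=> w /= h.
    move=> x xs; have := h (edge x); rewrite /B /= edge_depth_edge ?hs // in_itv /= andbT.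
    by apply; rewrite in_fset; exact: map_f.
  move=> e /=; rewrite in_fset => /mapP[x xs ->].
  by rewrite /B /= edge_depth_edge ?hs // in_itv /= andbT; exact: h.
move=> ->; [|move=> e /=|by move=> e; exact: measurable_itv]; last first.
  by rewrite in_fset => /mapP[x xs ->]; apply: edge_edges => //; exact: hs.
have -> : (\prod_(i <- J) P (C i @^-1` B i) = \prod_(i <- map edge s) P (C i @^-1` B i))%E.
  apply: perm_big; apply: uniq_perm; [exact: fset_uniq|exact: uE|].
  by move=> e; rewrite in_fset.
rewrite big_map big_seq [RHS]big_seq; apply: eq_bigr => x xs.
by rewrite /B edge_depth_edge ?hs // atleastE.
Qed.

(** ** Recurrence *)

Definition ancs m x := [seq anc j.+1 x | j <- index_iota m (depth x)].

Lemma uniq_ancs m x : uniq (ancs m x).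
Proof.
rewrite map_inj_in_uniq ?iota_uniq // => i j; rewrite !mem_index_iota => /andP[_ hi] /andP[_ hj] e.
by have := depth_anc htree hi; rewrite e depth_anc // => -[].
Qed.

Lemma mem_ancs m x y : (y \in ancs m x) = below y x && (m < depth y)%N.
Proof.
apply/mapP/andP => [[j]|[yx my]].
  rewrite mem_index_iota => /andP[mj jx] ->; split; first exact: anc_below.
  by rewrite depth_anc.
exists (depth y).-1; first by rewrite mem_index_iota; have := below_depth htree yx; lia.
by rewrite prednK; [apply/esym/eqP|lia].
Qed.

Lemma ancs_neq m x y : y \in ancs m x -> y != root.
Proof. by rewrite mem_ancs -(depth_eq0 _ htree) => /andP[_]; lia. Qed.

Lemma P_miss (x : V) (n : nat) : x != root -> (0 < n)%N ->
  P (allatleast (fun=> expR (- (n%:R `^ lam))) (ancs 0 x)) = ((1 - tail n%:R) ^+ depth x)%:E.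
Proof.
move=> xr n0; rewrite P_allatleast ?uniq_ancs //; last exact: ancs_neq.
rewrite big_map big_nat_cond (eq_bigr (fun=> (1 - tail n%:R)%:E)); last first.
  move=> j /andP[/andP[_ jx] _]; rewrite P_atleast ?ler1n //.
  by apply: edge_edges => //; rewrite -(depth_eq0 _ htree) depth_anc.
rewrite -big_nat_cond big_const_nat subn0; elim: (depth x) => //= k ->.
by rewrite exprS EFinM.
Qed.

(** The bad event is that the path to some edge of the truncated cutset meets
    no edge of small conductance.  The cutset is chosen with a sum below
    [exp(-n0^lam')], which forces all its edges to be deeper than [n0], where
    [miss_bound] applies. *)
Lemma recurrence_event (lam' : R) : 0 < lam' < lam ->
  (ereal_inf [set cutset_sum adj root lam' pi | pi in cutset adj root] <= 0)%E ->
  forall e : R, 0 < e -> exists B, [/\ measurable B, (P B <= e%:E)%E &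
    forall w, ~ B w -> ctot adj (Cw w) root * noret_lim adj root (Cw w) root <= e].
Proof.
move=> /andP[l'0 ll] inf0 e e0.
have [n0 [n00 Hn0]] := miss_bound hlam hL tail01 tail_mono ll.
pose del := Num.min e (expR (- (n0%:R `^ lam'))).
have del0 : 0 < del by rewrite lt_min e0 expR_gt0.
have [_ [pi cpi <-] pid] : exists2 y, [set cutset_sum adj root lam' pi | pi in cutset adj root] y & (y < del%:E)%E.
  by apply: ereal_inf_lt; apply: le_lt_trans inf0 _; rewrite lte_fin.
have [N [S [uS SE SN]]] := cutset_truncate htree hlf cpi.
have sumS : \sum_(x <- S) expR (- ((depth x)%:R `^ lam')) < del.
  by rewrite -lte_fin; apply: le_lt_trans pid; exact: cutset_sum_ge.
have Sdeep x : x \in S -> (n0 <= depth x)%N.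
  move=> xS; rewrite leqNgt; apply/negP => h.
  have : expR (- ((depth x)%:R `^ lam')) < expR (- (n0%:R `^ lam')).
    apply: le_lt_trans (lt_le_trans sumS _); last by rewrite ge_min lexx orbT.
    rewrite (big_rem x) //= lerDl sumr_ge0 // => y _; exact: expR_ge0.
  rewrite ltr_expR ltrN2 => h'.
  have : (depth x)%:R `^ lam' <= n0%:R `^ lam' :> R.
    by apply: ge0_ler_powR; rewrite ?nnegrE ?ler0n ?ler_nat ?(ltnW h) ?(ltW l'0).
  lra.
pose A x := allatleast (fun=> expR (- ((depth x)%:R `^ lam))) (ancs 0 x).
have [mB PB] := @le_measure_bigU _ _ _ P _ S A (fun x => expR (- ((depth x)%:R `^ lam'))) ltac:(
  move=> x xS; split; [exact: measurable_allatleast|];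
  have [xr _] := SE x xS; rewrite P_miss // ?lt0n ?depth_eq0 // lee_fin; exact: Hn0 (Sdeep x xS)).
exists [set w | exists2 x, x \in S & A x w]; split=> //.
  apply: le_trans PB _; rewrite lee_fin ltW //; apply: lt_le_trans sumS _.
  by rewrite ge_min lexx.
move=> w nB; have hc e1 : edges adj e1 -> 0 < C e1 w by exact: hpos.
pose b x := expR (- ((depth x)%:R `^ lam)).
pose F y := `[< exists x, [/\ x \in S, below y x & C (edge y) w <= b x] >].
apply: (@le_trans _ _ (\sum_(x <- S) b x)).
  apply: (@cut_noret _ _ root htree hlf hinf _ _ hc N F).
  - by move=> x _; exact: expR_ge0.
  - move=> v dv; have [x xS xv] := SN v dv.
    have : ~ A x w by move=> h; apply: nB; exists x.
    move=> /existsNP[y /not_implyP[yx /negP]]; rewrite -ltNge => h.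
    apply/hitP => //; exists y; split; first exact: ancs_neq yx.
      by apply: below_trans xv => //; move: yx; rewrite mem_ancs => /andP[].
    apply/asboolP; exists x; split=> //; last exact: ltW.
    by move: yx; rewrite mem_ancs => /andP[].
  - by move=> y _ /asboolP.
apply: le_trans (le_trans (ltW sumS) _); last by rewrite ge_min lexx.
rewrite big_seq [leRHS]big_seq; apply: ler_sum => x xS.
rewrite ler_expR lerN2 ler_powR ?ler1n // 1?ltW //.
by apply: leq_trans (Sdeep x xS).
Qed.

Lemma ae_recurrence (lam' : R) : 0 < lam' < lam ->
  (ereal_inf [set cutset_sum adj root lam' pi | pi in cutset adj root] <= 0)%E ->
  {ae P, forall w, noret_lim adj root (Cw w) root = 0}.
Proof.
move=> ll inf0.
have H (j : nat) : {ae P, forall w, ctot adj (Cw w) root * noret_lim adj root (Cw w) root <= j.+1%:R^-1}.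
  apply: small_null => e e0.
  have [|B [mB PB HB]] := @recurrence_event _ ll inf0 (Num.min e j.+1%:R^-1).
    by rewrite lt_min e0 invr_gt0 ltr0n.
  exists B; split=> //.
    by apply: le_trans PB _; rewrite lee_fin ge_min lexx.
  by move=> w /HB h; apply: le_trans h _; rewrite ge_min lexx orbT.
have := ae_foralln H; apply: filterS => w h.
have hc e1 : edges adj e1 -> 0 < C e1 w by exact: hpos.
have c0 := ctot_gt0 htree hlf hinf hc root.
apply/eqP; rewrite eq_le noret_lim_ge0 // andbT leNgt; apply/negP => l0.
have p0 : 0 < ctot adj (Cw w) root * noret_lim adj root (Cw w) root by exact: mulr_gt0.
have := h (Num.truncn (ctot adj (Cw w) root * noret_lim adj root (Cw w) root)^-1).
rewrite -[leLHS]invrK lef_pV2 ?posrE ?invr_gt0 // leNgt => /negP; apply.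
exact: truncnS_gt.
Qed.

(** ** Transience *)

(** A conserved flow is generated by its values on the leaves. *)
Lemma flow_sum (N : nat) (th : V -> R) :
  (forall x, (depth x < N)%N -> \sum_(y <- kids x) th y = th x) ->
  forall x, (depth x <= N)%N -> flow_of adj root N th x = th x.
Proof.
move=> hth x; move En : (N - depth x)%N => n; elim: n x En => [|n IH] x En xN.
  have dx : depth x = N by lia.
  have xl : x \in lev N by rewrite mem_lev // dx.
  rewrite /flow_of big_mkcond (bigD1_seq x) ?uniq_lev //= belowxx big1_seq ?addr0 //.
  move=> l /andP[lx]; rewrite mem_lev // => /eqP dl; case: ifPn => // xl'.
  by move: lx; rewrite (below_depth_eq xl') ?eqxx // dx dl.
rewrite -flow_of_kids //; last lia.
rewrite -hth; last lia.
rewrite big_seq [RHS]big_seq; apply: eq_bigr => y yk.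
by apply: IH; rewrite (kids_depth yk); lia.
Qed.

Definition keep_prob j : R := 1 - tail j.+1%:R.
Definition threshold k : R := expR (- (k%:R `^ lam)).
Definition max_resistance k : R := expR (k%:R `^ lam).
(** Percolation is only performed below depth [m]: the path to [l] is open if
    its edges deeper than [m] are. *)
Definition opened m l := allatleast threshold (ancs m l).
Definition same l l' j := anc j.+1 l == anc j.+1 l'.
(** For two leaves whose paths split at depth [k]: one plus the largest
    resistance of an open common part, divided by the probability that the
    common part is open, both taken below depth [m]. *)
Definition gain m k : R := (1 + \sum_(m <= j < k) max_resistance j.+1) / \prod_(m <= j < k) keep_prob j.

Lemma P_thr j e : edges adj e -> P (atleast (threshold j.+1) e) = (keep_prob j)%:E.
Proof. by move=> he; rewrite P_atleast // ler1n. Qed.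

Lemma anc_neq j l : (j < depth l)%N -> anc j.+1 l != root.
Proof. by move=> jl; rewrite -(depth_eq0 _ htree) depth_anc. Qed.

Lemma prod_ancs (m : nat) (l : V) (Q : pred V) :
  (\prod_(x <- ancs m l | Q x) P (atleast (threshold (depth x)) (edge x)) =
  (\prod_(m <= j < depth l | Q (anc j.+1 l)) keep_prob j)%:E)%E.
Proof.
rewrite big_map big_nat_cond (eq_bigr (fun j => (keep_prob j)%:E)); last first.
  move=> j /andP[/andP[_ jl] _]; rewrite depth_anc // P_thr //.
  by apply: edge_edges => //; exact: anc_neq.
by rewrite -big_nat_cond; elim/big_rec2: _ => // j x y _ ->; rewrite EFinM.
Qed.

Lemma P_opened m l : P (opened m l) = (\prod_(m <= j < depth l) keep_prob j)%:E.
Proof.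
rewrite P_allatleast ?uniq_ancs //; last by move=> x; exact: ancs_neq.
by rewrite prod_ancs.
Qed.

Lemma same_ancs (m j : nat) (l l' : V) : (m <= j < depth l')%N -> depth l = depth l' ->
  (anc j.+1 l' \in ancs m l) = same l l' j.
Proof.
move=> /andP[mj jl] dl; rewrite mem_ancs below_anc depth_anc // ltnS mj andbT.
by rewrite /same.
Qed.

(** The union of two paths counts their common edges once. *)
Lemma P_opened2 m l l' : depth l = depth l' ->
  fine (P (opened m l `&` opened m l')) * \prod_(m <= j < depth l | same l l' j) keep_prob j
  = (\prod_(m <= j < depth l) keep_prob j) ^+ 2.
Proof.
move=> dl; pose s := ancs m l ++ [seq y <- ancs m l' | y \notin ancs m l].
have -> : opened m l `&` opened m l' = allatleast threshold s.
  apply/seteqP; split=> w /=.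
    by move=> [h1 h2] x; rewrite mem_cat => /orP[/h1//|]; rewrite mem_filter => /andP[_ /h2].
  move=> h; split=> x xl; apply: h; rewrite mem_cat ?xl //.
  by rewrite mem_filter xl andbT orbN.
rewrite P_allatleast; last 2 first.
- rewrite cat_uniq uniq_ancs filter_uniq ?uniq_ancs //= andbT.
  by apply/hasPn => x; rewrite mem_filter => /andP[].
- move=> x; rewrite mem_cat => /orP[|]; first exact: ancs_neq.
  by rewrite mem_filter => /andP[_]; exact: ancs_neq.
rewrite big_cat /= prod_ancs big_filter prod_ancs -EFinM /= -dl.
rewrite expr2 -mulrA; congr (_ * _).
rewrite [RHS](bigID (same l l')) /= mulrC; congr (_ * _).
rewrite big_nat_cond [RHS]big_nat_cond; apply: eq_bigl => j.
case: (boolP (m <= j < depth l)%N) => //= h.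
by rewrite same_ancs // -dl.
Qed.

Lemma same_prefix l l' i j : (i <= j)%N -> (j < depth l)%N -> depth l = depth l' ->
  same l l' j -> same l l' i.
Proof.
move=> ij jl dl /eqP e; apply/eqP.
by rewrite -(anc_anc htree (k := j.+1) (x := l)) // e anc_anc // -dl.
Qed.

Lemma gain_ge0 m k : (forall j, (m <= j)%N -> 0 < keep_prob j) -> 0 <= gain m k.
Proof.
move=> k0; rewrite /gain divr_ge0 //.
  by rewrite addr_ge0 // sumr_ge0 // => j _; exact: expR_ge0.
by rewrite big_nat_cond; apply: prodr_ge0 => j /andP[/andP[mj _] _]; rewrite ltW // k0.
Qed.

(** Since [sm] is an initial segment, the left-hand side is a single value of
    [gain], or 1 if [sm] is empty; the sum on the right contains it. *)
Lemma gain_prefix (m n : nat) (sm : pred nat) : (forall j, (m <= j)%N -> 0 < keep_prob j) ->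
  (forall i j, (i <= j)%N -> (j < m + n)%N -> sm j -> sm i) ->
  (1 + \sum_(m <= j < m + n | sm j) max_resistance j.+1) / (\prod_(m <= j < m + n | sm j) keep_prob j)
    <= 1 + \sum_(m <= j < m + n | sm j) gain m j.+1.
Proof.
move=> k0; elim: n => [|n IH] hs; first by rewrite addn0 !big_geq // invr1 mulr1.
have [smn|smn] := boolP (sm (m + n)%N); last first.
  have e1 (F : nat -> R) : \sum_(m <= j < m + n.+1 | sm j) F j = \sum_(m <= j < m + n | sm j) F j.
    by rewrite big_mkcond addnS big_nat_recr ?leq_addr //= (negbTE smn) addr0 -big_mkcond.
  have e2 (F : nat -> R) : \prod_(m <= j < m + n.+1 | sm j) F j = \prod_(m <= j < m + n | sm j) F j.
    by rewrite big_mkcond addnS big_nat_recr ?leq_addr //= (negbTE smn) mulr1 -big_mkcond.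
  rewrite !e1 e2; apply: IH => i j ij jn; apply: hs => //.
  by rewrite addnS ltnS ltnW.
have all_ j : (m <= j < m + n.+1)%N -> sm j.
  by rewrite addnS ltnS => /andP[_ h]; apply: hs h _ smn; rewrite addnS.
have e1 (F : nat -> R) : \sum_(m <= j < m + n.+1 | sm j) F j = \sum_(m <= j < m + n.+1) F j.
  rewrite big_nat_cond [RHS]big_nat_cond; apply: eq_bigl => j.
  by case: (boolP (m <= j < m + n.+1)%N) => //= /all_ ->.
have e2 (F : nat -> R) : \prod_(m <= j < m + n.+1 | sm j) F j = \prod_(m <= j < m + n.+1) F j.
  rewrite big_nat_cond [RHS]big_nat_cond; apply: eq_bigl => j.
  by case: (boolP (m <= j < m + n.+1)%N) => //= /all_ ->.
rewrite !e1 e2 -/(gain m (m + n.+1)) addnS big_nat_recr ?leq_addr //=.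
rewrite addrA ler_wpDl // addr_ge0 // sumr_ge0 // => j _; exact: gain_ge0.
Qed.

(** From here on [th] is a unit flow to level [N] bounded by [cap], and the
    random leaf masses are the normalised restrictions of [th] to the open
    paths. *)
Section SecondMoment.
Variables (m N : nat) (th : V -> R) (cap : nat -> R).
Hypothesis mN : (m < N)%N.
Hypothesis m0 : (0 < m)%N.
Hypothesis keep0 : forall j, (m <= j)%N -> 0 < keep_prob j.
Hypothesis th0 : forall x, 0 <= th x.
Hypothesis th1 : th root = 1.
Hypothesis th_sum : forall x, (depth x < N)%N -> \sum_(y <- kids x) th y = th x.
Hypothesis th_cap : forall x, x != root -> (depth x <= N)%N -> th x <= cap (depth x).
Hypothesis gain_cap : forall k, (m < k)%N -> gain m k * cap k <= k.-1%:R^-1 - k%:R^-1.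

Let W : R := \prod_(m <= j < N) keep_prob j.

Let W0 : 0 < W.
Proof. by rewrite /W big_nat_cond; apply: prodr_gt0 => j /andP[/andP[mj _] _]; exact: keep0. Qed.

Lemma sum_th_lev : \sum_(l <- lev N) th l = 1.
Proof.
rewrite -th1 -(flow_sum th_sum); last by rewrite depth_root.
by rewrite /flow_of; apply: eq_bigl => l; rewrite below_root.
Qed.

Let weight l l' : R := 1 + \sum_(m <= j < N | same l l' j) max_resistance j.+1.
Let pair_coef (u : V * V) : R := th u.1 * th u.2 * weight u.1 u.2 / W ^+ 2.
Let pair_open (u : V * V) := opened m u.1 `&` opened m u.2.
Let pairs := [seq (l, l') | l <- lev N, l' <- lev N].

Let weight_ge0 l l' : 0 <= weight l l'.
Proof. by rewrite addr_ge0 // sumr_ge0 // => j _; exact: expR_ge0. Qed.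

Let pair_coef_ge0 u : 0 <= pair_coef u.
Proof. by rewrite /pair_coef !mulr_ge0 ?invr_ge0 ?exprn_ge0 ?(ltW W0). Qed.

(** Pairs of leaves with the same ancestor at depth [j.+1]: the flow through
    that ancestor is at most [cap j.+1], and the total flow is one. *)
Lemma overlap_sum j : (m <= j < N)%N ->
  \sum_(l <- lev N) \sum_(l' <- lev N | same l l' j) th l * th l' <= cap j.+1.
Proof.
move=> /andP[mj jN].
apply: (@le_trans _ _ (\sum_(l <- lev N) th l * cap j.+1)); last first.
  by rewrite -mulr_suml sum_th_lev mul1r.
rewrite big_seq [leRHS]big_seq; apply: ler_sum => l; rewrite mem_lev // => /eqP dl.
rewrite -mulr_sumr ler_wpM2l //.
have da : depth (anc j.+1 l) = j.+1 by rewrite depth_anc // dl.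
have <- : flow_of adj root N th (anc j.+1 l) = \sum_(l' <- lev N | same l l' j) th l'.
  rewrite /flow_of; apply: eq_bigl => l'.
  by rewrite below_anc da /same eq_sym.
rewrite flow_sum ?da // -[in leRHS]da; apply: th_cap; last by rewrite da.
by apply: anc_neq; rewrite dl.
Qed.

(** This bounds the expectation of [total^2 + energy] ([total_energy]). *)
Lemma second_moment :
  \sum_(u <- pairs) pair_coef u * fine (P (pair_open u)) <= 1 + m%:R^-1.
Proof.
rewrite /pairs big_allpairs_dep.
pose B l l' := th l * th l' + \sum_(m <= j < N) (if same l l' j then th l * th l' * gain m j.+1 else 0).
apply: (@le_trans _ _ (\sum_(l <- lev N) \sum_(l' <- lev N) B l l')).
  rewrite big_seq [leRHS]big_seq; apply: ler_sum => l; rewrite mem_lev // => /eqP dl.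
  rewrite big_seq [leRHS]big_seq; apply: ler_sum => l'; rewrite mem_lev // => /eqP dl'.
  have dd : depth l = depth l' by rewrite dl dl'.
  have := P_opened2 m dd; rewrite dl -/W => e2.
  set Wc := \prod_(m <= j < N | same l l' j) keep_prob j in e2.
  have Wc0 : 0 < Wc.
    by rewrite /Wc big_nat_cond; apply: prodr_gt0 => j /andP[/andP[mj _] _]; exact: keep0.
  have -> : pair_coef (l, l') * fine (P (pair_open (l, l'))) =
      th l * th l' * (weight l l' / Wc).
    rewrite /pair_coef /pair_open /= -e2; field.
    rewrite (gt_eqF Wc0) /=; apply/eqP => e0; move: e2; rewrite e0 mul0r => /esym/eqP.
    by rewrite expf_eq0 (gt_eqF W0).
  have -> : B l l' = th l * th l' * (1 + \sum_(m <= j < N | same l l' j) gain m j.+1).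
    rewrite /B mulrDr mulr1 mulr_sumr; congr (_ + _).
    by rewrite [RHS]big_mkcond.
  rewrite ler_wpM2l ?mulr_ge0 //.
  have := @gain_prefix m (N - m) (same l l') keep0; rewrite subnKC ?(ltnW mN) //; apply.
  by move=> i j ij jN; apply: same_prefix => //; rewrite dl.
rewrite /B; under eq_bigr do rewrite big_split /=.
rewrite big_split /=; apply: lerD.
  under eq_bigr do rewrite -mulr_sumr sum_th_lev mulr1.
  by rewrite sum_th_lev.
under eq_bigr do rewrite exchange_big /=.
rewrite exchange_big /=.
apply: (@le_trans _ _ (\sum_(m <= j < N) (j%:R^-1 - j.+1%:R^-1))).
  rewrite big_nat_cond [leRHS]big_nat_cond; apply: ler_sum => j /andP[mj _].
  apply: le_trans (gain_cap (k := j.+1) _); last by case/andP: mj.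
  have -> : \sum_(l <- lev N) \sum_(l' <- lev N) (if same l l' j then th l * th l' * gain m j.+1 else 0)
    = gain m j.+1 * \sum_(l <- lev N) \sum_(l' <- lev N | same l l' j) th l * th l'.
    rewrite mulr_sumr; apply: eq_bigr => l _; rewrite mulr_sumr [RHS]big_mkcond.
    by apply: eq_bigr => l' _; case: ifP; rewrite // mulrC.
  by rewrite ler_wpM2l ?gain_ge0 // overlap_sum.
have -> : \sum_(m <= j < N) (j%:R^-1 - j.+1%:R^-1) = m%:R^-1 - N%:R^-1 :> R.
  have := telescope_sumr (fun j => - (j%:R^-1 : R)) (ltnW mN).
  rewrite opprK addrC => <-; apply: eq_bigr => j _; by rewrite opprK addrC.
by rewrite gerBl invr_ge0.
Qed.

Definition mass (w : T) (l : V) : R := th l * \1_(opened m l) w / W.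
Definition total w : R := \sum_(l <- lev N) mass w l.
Definition energy w : R := \sum_(l <- lev N) mass w l *
  (\sum_(m <= k < N) max_resistance k.+1 * flow_of adj root N (mass w) (anc k.+1 l)).
(** Off this event the total mass is at least 1/2 and the energy at most
    1/4. *)
Definition bad : set T := [set w | 4^-1 <= (total w - 1) ^+ 2 + energy w].

Lemma mass_ge0 w l : 0 <= mass w l.
Proof. by rewrite /mass !mulr_ge0 // invr_ge0 ltW. Qed.

Lemma total_energy w : total w ^+ 2 + energy w =
  \sum_(u <- pairs) pair_coef u * \1_(pair_open u) w.
Proof.
rewrite /pairs big_allpairs_dep expr2 {1}/total mulr_suml /energy -big_split /=.
rewrite big_seq [RHS]big_seq; apply: eq_bigr => l; rewrite mem_lev // => /eqP dl.
rewrite -mulrDr; transitivity (mass w l * \sum_(l' <- lev N) mass w l' * weight l l').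
  congr (_ * _); under [RHS]eq_bigr do rewrite mulrDr mulr1.
  rewrite [RHS]big_split /=; congr (_ + _).
  under [RHS]eq_bigr do rewrite mulr_sumr big_mkcond /=.
  rewrite [RHS]exchange_big /= big_nat_cond [RHS]big_nat_cond.
  apply: eq_bigr => k /andP[/andP[_ kN] _].
  rewrite /flow_of mulr_sumr big_mkcond; apply: eq_bigr => l' _.
  have -> : below (anc k.+1 l) l' = same l l' k.
    by rewrite below_anc depth_anc ?dl // /same eq_sym.
  by case: ifP; rewrite // mulrC.
rewrite mulr_sumr; apply: eq_bigr => l' _.
rewrite /pair_coef /pair_open /mass /= indicI /=.
by field; rewrite (gt_eqF W0).
Qed.

Lemma measurable_opened l : measurable (opened m l).
Proof. exact: measurable_allatleast. Qed.

Lemma badE : bad = [set w | 4^-1 <=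
  (\sum_(u <- pairs) pair_coef u * \1_(pair_open u) w) - 2 * total w + 1].
Proof.
apply/seteqP; split=> w; rewrite /bad /= -total_energy sqrrB1 => h; apply: le_trans h _;
rewrite le_eqVlt; apply/orP; left; apply/eqP; rewrite -[_ *+ 2]mulr_natl; ring.
Qed.

Lemma measurable_bad : measurable bad.
Proof.
pose f w := (\sum_(u <- pairs) pair_coef u * \1_(pair_open u) w) - 2 * total w + 1.
have mf : measurable_fun setT f.
  apply: measurable_funD => //; apply: measurable_funB.
    apply: measurable_sum => u; apply: measurable_funM => //.
    by apply: measurable_indic; apply: measurableI; exact: measurable_opened.
  apply: measurable_funM => //; apply: measurable_sum => l.
  rewrite /mass; apply: measurable_funM => //; apply: measurable_funM => //.
  by apply: measurable_indic; exact: measurable_opened.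
have -> : bad = setT `&` f @^-1` `[4^-1, +oo[%classic.
  by rewrite badE setTI; apply/seteqP; split=> w /=; rewrite in_itv /= andbT.
by apply: mf => //; exact: measurable_itv.
Qed.

(** Markov's inequality for [(total - 1)^2 + energy]: as [total] has mean one,
    its expectation is the second moment minus one. *)
Lemma P_bad : (P bad <= (4 / m%:R)%:E)%E.
Proof.
have fin : P bad \is a fin_num by apply: fin_num_measure; exact: measurable_bad.
rewrite -(fineK fin) lee_fin.
have en0 w : 0 <= energy w.
  apply: sumr_ge0 => l _; rewrite mulr_ge0 ?mass_ge0 // sumr_ge0 // => k _.
  by rewrite mulr_ge0 ?expR_ge0 // sumr_ge0 // => l' _; exact: mass_ge0.
have H : 4^-1 * fine (P bad) + \sum_(l <- lev N) 2 * th l / W * fine (P (opened m l)) <=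
    1 + \sum_(u <- pairs) pair_coef u * fine (P (pair_open u)).
  apply: expect_le => //; first exact: measurable_bad.
  - by move=> l; rewrite !mulr_ge0 ?invr_ge0 ?(ltW W0).
  - exact: measurable_opened.
  - by move=> u; apply: measurableI; exact: measurable_opened.
  move=> w; rewrite -total_energy.
  have -> : \sum_(l <- lev N) 2 * th l / W * \1_(opened m l) w = 2 * total w.
    by rewrite /total mulr_sumr; apply: eq_bigr => l _; rewrite /mass; ring.
  have e0w := en0 w; rewrite indicE; have [wb|_] := boolP (w \in bad).
    by move: wb; rewrite inE /bad /= => wb; nra.
  by have := sqr_ge0 (total w - 1); rewrite /=; nra.
have sm := second_moment.
have e : \sum_(l <- lev N) 2 * th l / W * fine (P (opened m l)) = 2.
  transitivity (\sum_(l <- lev N) 2 * th l); last by rewrite -mulr_sumr sum_th_lev mulr1.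
  rewrite big_seq [RHS]big_seq; apply: eq_bigr => l; rewrite mem_lev // => /eqP dl.
  by rewrite P_opened dl -/W /= divfK // gt_eqF.
rewrite e in H.
lra.
Qed.

Lemma good_noret_bad w : ~ bad w ->
  forall kap : R, 0 < kap ->
  (forall x, x != root -> (depth x <= m)%N -> kap <= C (edge x) w) ->
  forall n, (n <= N)%N ->
    (ctot adj (Cw w) root * (m%:R / kap + 4))^-1 <= noret adj root (Cw w) n root \/ n = 0%N.
Proof.
move=> /negP; rewrite -ltNge => gd kap k0 hk.
have hc e1 : edges adj e1 -> 0 < C e1 w by exact: hpos.
have en0 : 0 <= energy w.
  apply: sumr_ge0 => l _; rewrite mulr_ge0 ?mass_ge0 // sumr_ge0 // => k _.
  by rewrite mulr_ge0 ?expR_ge0 // sumr_ge0 // => l' _; exact: mass_ge0.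
apply: (@good_noret _ _ root htree hlf hinf _ _ hc m N kap (mass w) max_resistance) => //.
- exact: ltnW.
- exact: mass_ge0.
- by move=> k; exact: expR_ge0.
- move=> l x dl ml xr xl mx.
  have wo : opened m l w.
    apply: contrapT => h; move/eqP: ml; apply.
    by rewrite /mass indicE memNset // mulr0 mul0r.
  rewrite /max_resistance -[leRHS]invrK -expRN lef_pV2 ?posrE ?expR_gt0 //; last exact/hc/edge_edges.
  by apply: wo; rewrite mem_ancs xl mx.
- rewrite -/(total w); have := sqr_ge0 (total w - 1); nra.
- by rewrite -/(energy w); have := sqr_ge0 (total w - 1); lra.
Qed.

End SecondMoment.

Lemma exists_kappa m w : exists2 kap : R, 0 < kap &
  forall x, x != root -> (depth x <= m)%N -> kap <= C (edge x) w.
Proof.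
have H (s : seq V) : exists2 kap : R, 0 < kap & forall x, x \in s -> x != root -> kap <= C (edge x) w.
  elim: s => [|a s [kap k0 hk]]; first by exists 1.
  have [->|ar] := eqVneq a root.
    exists kap => // x; rewrite inE => /orP[/eqP ->|]; last exact: hk.
    by rewrite eqxx.
  exists (Num.min kap (C (edge a) w)).
    by rewrite lt_min k0 hpos //; exact: edge_edges.
  move=> x; rewrite inE => /orP[/eqP ->|xs] xr; rewrite ge_min ?lexx ?orbT // hk //.
have [kap k0 hk] := H (flatten [seq lev k | k <- iota 0 m.+1]).
exists kap => // x xr xm; apply: hk => //.
apply/flattenP; exists (lev (depth x)); last by rewrite mem_lev.
by apply/map_f; rewrite mem_iota.
Qed.

(** The good events for the truncation levels [m + i] need not be monotone in
    [i], but outside an event of probability at most [4/m] infinitely many of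
    them occur, and each bounds [noret n] for all smaller [n]. *)
Lemma transience_event (lam' c0 : R) : lam < lam' -> 0 < c0 ->
  (c0%:E <= ereal_inf [set cutset_sum adj root lam' pi | pi in cutset adj root])%E ->
  forall e : R, 0 < e -> exists B, [/\ measurable B, (P B <= e%:E)%E &
    forall w, ~ B w -> exists2 b : R, 0 < b & forall n, b <= noret adj root (Cw w) n root].
Proof.
move=> ll c00 hc0 e e0.
have [m0 [m00 qh Hm]] := series_bound hlam hL tail01 ll c00.
pose m := maxn m0 (Num.truncn (4 / e)).+1.
have mm0 : (m0 <= m)%N by rewrite leq_maxl.
have mpos : (0 < m)%N by exact: leq_trans mm0.
have me : 4 / m%:R <= e.
  have mR : 0 < m%:R :> R by rewrite ltr0n.
  rewrite ler_pdivrMr // mulrC -ler_pdivrMr // ltW //.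
  by apply: lt_le_trans (truncnS_gt _) _; rewrite ler_nat leq_maxr.
have keep0 j : (m <= j)%N -> 0 < keep_prob j.
  move=> mj; rewrite /keep_prob /tail; have := qh j.+1 (leq_trans mm0 (leqW mj)); lra.
have [th Hth] := choice (flow_exists htree hlf c00 hc0).
pose cap k : R := expR (- (k%:R `^ lam')) / c0.
have gc k : (m < k)%N -> gain m k * cap k <= k.-1%:R^-1 - k%:R^-1.
  by move=> mk; exact: Hm.
pose Bd i := bad m (m + i).+1 (th (m + i)%N).
have mi i : (m < (m + i).+1)%N by rewrite ltnS leq_addr.
have mBd i : measurable (Bd i) by have [t0 t1 t2 t3] := Hth (m + i)%N; exact: measurable_bad.
have PBd i : (P (Bd i) <= e%:E)%E.
  have [t0 t1 t2 t3] := Hth (m + i)%N.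
  apply: (@le_trans _ _ (4 / m%:R)%:E); last by rewrite lee_fin.
  by apply: (@P_bad m (m + i).+1 _ cap).
pose F j := \bigcap_(i in [set i | (j <= i)%N]) Bd i.
have mF j : measurable (F j) by exact: bigcap_measurableType.
have mB : measurable (\bigcup_j F j) by exact: bigcup_measurable.
exists (\bigcup_j F j); split=> //.
  have cv : P (F n) @[n --> \oo] --> P (\bigcup_j F j).
    apply: nondecreasing_cvg_mu => //.
    by move=> i j ij; apply/subsetPset => w h k /= jk; apply: h; exact: leq_trans jk.
  rewrite -(cvg_lim _ cv) //; apply: lime_le; first by apply/cvg_ex; eexists; exact: cv.
  apply: nearW => j; apply: le_trans (PBd j); apply: le_measure; rewrite ?inE //.
  by move=> w; apply; exact: leqnn.
move=> w nB; have hc e1 : edges adj e1 -> 0 < C e1 w by exact: hpos.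
have c0' := ctot_gt0 htree hlf hinf hc root.
have [kap k0 hk] := exists_kappa m w.
exists (ctot adj (Cw w) root * (m%:R / kap + 4))^-1.
  by rewrite invr_gt0 mulr_gt0 // ltr_wpDl // divr_ge0 // ltW.
have key n : (ctot adj (Cw w) root * (m%:R / kap + 4))^-1 <= noret adj root (Cw w) n.+1 root.
  have : ~ F n w by move=> h; apply: nB; exists n.
  move=> /existsNP[i /not_implyP[/= ni nb]].
  have [t0 t1 t2 t3] := Hth (m + i)%N.
  have nN : (n.+1 <= (m + i).+1)%N by rewrite ltnS (leq_trans ni) // leq_addl.
  suff [h|//] : (ctot adj (Cw w) root * (m%:R / kap + 4))^-1 <=
      noret adj root (Cw w) n.+1 root \/ n.+1 = 0%N by exact: h.
  by apply: (good_noret_bad (N := (m + i).+1) (th := th (m + i)%N)).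
by case=> [|n]; [apply: le_trans (key 0%N) _; exact: noret_nincr|exact: key].
Qed.

Lemma ae_transience (lam' c0 : R) : lam < lam' -> 0 < c0 ->
  (c0%:E <= ereal_inf [set cutset_sum adj root lam' pi | pi in cutset adj root])%E ->
  {ae P, forall w, exists2 b : R, 0 < b & forall n, b <= noret adj root (Cw w) n root}.
Proof. by move=> ll c00 hc0; apply: small_null; exact: transience_event ll c00 hc0. Qed.

End Network.

(** * The phase transition *)

Unset Implicit Arguments.
Theorem theorem3p4
  (R : realType)
  (V : choiceType) (adj : rel V) (root : V)
  (htree : is_tree adj)
  (hlf : locally_finite adj)
  (hinf : infinite_set [set: V])
  (hgrowth : intermediate_growth adj root R)
  (lam : R) (hlam : 0 < lam < 1)
  (d : measure_display) (T : measurableType d) (P : probability T R)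
  (C : {fset V} -> {RV P >-> R})
  (hpos : forall e w, edges adj e -> 0 < C e w)
  (hindep : independent_on (edges adj) C)
  (hident : identically_distributed_on (edges adj) C)
  (L : R -> R) (hL : slowly_varying L)
  (htail : forall (t : R) (e : {fset V}), 1 <= t -> edges adj e ->
     P [set w | C e w < expR (- (t `^ lam))] = (L t * t `^ (lam - 1))%:E) :
  ((IBN adj root R < lam%:E)%E ->
     {ae P, forall w,
        forall (d' : measure_display) (T' : measurableType d')
               (Q : probability T' R) (X : nat -> T' -> V),
          random_walk adj root (fun e => C e w) Q X -> recurrent root Q X})
  /\
  ((lam%:E < IBN adj root R)%E ->
     {ae P, forall w,
        forall (d' : measure_display) (T' : measurableType d')
               (Q : probability T' R) (X : nat -> T' -> V),
          random_walk adj root (fun e => C e w) Q X -> transient root Q X}).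
Proof.
have [l0 l1] : 0 < lam /\ lam < 1 by apply/andP.
have IBN0 : (0 <= IBN adj root R)%E by apply: ereal_sup_ubound; left.
have mem lam' : 0 < lam' ->
    (0 < ereal_inf [set cutset_sum adj root lam' pi | pi in cutset adj root])%E ->
    (lam'%:E <= IBN adj root R)%E.
  by move=> h1 h2; apply: ereal_sup_ubound; right; exists lam'.
split=> h.
  have [a Ea] : exists a : R, IBN adj root R = a%:E.
    by case: (IBN adj root R) IBN0 h => [a| |] //; exists a.
  move: IBN0 h; rewrite Ea lee_fin lte_fin => a0 al.
  pose lam' := (a + lam) / 2.
  have l'0 : 0 < lam' by rewrite /lam'; lra.
  have inf0 : (ereal_inf [set cutset_sum adj root lam' pi | pi in cutset adj root] <= 0)%E.
    rewrite leNgt; apply/negP => /(mem _ l'0); rewrite Ea lee_fin /lam'; lra.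
  have ll : 0 < lam' < lam by apply/andP; split=> //; rewrite /lam'; lra.
  have := ae_recurrence htree hlf hinf hlam hpos hindep hL htail ll inf0.
  apply: filterS => w lim0 d' T' Q X hX.
  have hc e : edges adj e -> 0 < C e w by exact: hpos.
  apply: (recurrent_of_noret htree hlf hinf hc hX) => e e0.
  have [n hn] := noret_lim_near root htree hlf hinf hc e0.
  by exists n; rewrite lim0 add0r in hn.
have [y] := ereal_sup_gt h; case=> [->|[lam' [l'0 inf0] <-]].
  by rewrite lte_fin ltNge ltW.
rewrite lte_fin => ll.
have [c0 c00 hc0] : exists2 c0 : R, 0 < c0 &
    (c0%:E <= ereal_inf [set cutset_sum adj root lam' pi | pi in cutset adj root])%E.
  case: (ereal_inf _) inf0 => [r||] //; rewrite ?lte_fin => r0; first by exists r.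
  by exists 1; rewrite ?leey.
have := ae_transience htree hlf hinf hlam hpos hindep hL htail ll c00 hc0.
apply: filterS => w [b b0 hb] d' T' Q X hX.
have hc e : edges adj e -> 0 < C e w by exact: hpos.
exact: (transient_of_noret htree hlf hinf hc hX b0 hb).
Qed.
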